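(* Let $(X_t)_{t \in \mathbb{Z}}$ be a strictly stationary process in $\mathbb{R}^d$, jointly regularly varying of index $\alpha \in (0,\infty)$, let $\|\cdot\|$ be a norm on $\mathbb{R}^d$, and let $(Y_t)_{t \in \mathbb{Z}}$ be a process in $\mathbb{R}^d$ such that $\Pr(\|Y_0\|>y)=y^{-\alpha}$ for $y\ge 1$ and for all integers $s \leq t$ the conditional law of $(x^{-1}X_s, \ldots, x^{-1}X_t)$ given $\|X_0\| > x$ converges weakly to the law of $(Y_s, \ldots, Y_t)$ as $x \to \infty$. Define $\Theta_t = Y_t/\|Y_0\|$ for $t \in \mathbb{Z}$. Then: (i) $\|Y_0\|$ is independent of $(\Theta_t)_{t \in \mathbb{Z}}$. (ii) For all $i, s, t \in \mathbb{Z}$ with $s \leq 0 \leq t$ and all bounded continuous $f : (\mathbb{R}^d)^{t-s+1} \to \mathbb{R}$ satisfying $f(y_s, \ldots, y_t) = 0$ whenever $y_0 = 0$, \[ \mathrm{E}[f(\Theta_{s-i}, \ldots, \Theta_{t-i})] = \mathrm{E}\Bigl[ f\Bigl(\frac{\Theta_s}{\|\Theta_i\|}, \ldots, \frac{\Theta_t}{\|\Theta_i\|}\Bigr) \|\Theta_i\|^\alpha \Bigr]. \]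
   Context: A random vector $X$ in $\mathbb{R}^k$ is regularly varying of index $\alpha$ if for some norm $\|\cdot\|$ there is a random vector $\Theta$ on the unit sphere such that for each $u>0$, $\Pr(\|X\| > ux, X/\|X\| \in \cdot)/\Pr(\|X\|>x) \to u^{-\alpha}\Pr(\Theta \in \cdot)$ weakly as $x\to\infty$. A stationary process $(X_t)$ in $\mathbb{R}^d$ is jointly regularly varying of index $\alpha$ if every $(X_1,\ldots,X_k)$, $k \ge 1$, is regularly varying of index $\alpha$. The process $(Y_t)$ (which exists by joint regular variation) is called the tail process and $(\Theta_t)$ the spectral process. In (ii), the integrand on the right is interpreted as $0$ when $\Theta_i = 0$. *)

(* Defs.v *)
From HB Require Import structures.
From mathcomp Require Import all_boot all_order all_algebra.
From mathcomp Require Import all_classical all_reals all_analysis.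
Set Implicit Arguments. Unset Strict Implicit. Unset Printing Implicit Defensive.
Import Order.TTheory GRing.Theory Num.Theory.
Import numFieldNormedType.Exports.
Local Open Scope classical_set_scope.
Local Open Scope ring_scope.

Section defs.
Context {R : realType}.

Definition mxBorel (m n : nat) : set (set 'M[R]_(m, n)) := <<s open >>.

Definition mxB (m n : nat) := g_sigma_algebraType (@open 'M[R]_(m, n)).

Definition rand_mx {dT} {T : measurableType dT} (m n : nat)
  (Z : T -> 'M[R]_(m, n)) : Prop :=
  forall B, mxBorel B -> measurable (Z @^-1` B).

Definition is_norm (V : lmodType R) (N : V -> R) : Prop :=
  [/\ forall x y, N (x + y) <= N x + N y,
      forall (a : R) x, N (a *: x) = `|a| * N x
    & forall x, N x = 0 -> x = 0].

Definition bounded_cont (m n : nat) (f : 'M[R]_(m, n) -> R) : Prop :=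
  continuous f /\ exists M : R, forall z, `|f z| <= M.

Definition window (d : nat) (Z : int -> 'rV[R]_d) (s : int) (n : nat)
  : 'M[R]_(n, d) := \matrix_(i < n, j < d) Z (s + (i : nat)%:Z) ord0 j.

Definition Ex {dT} {T : measurableType dT} (P : probability T R)
  (g : T -> R) : \bar R := (\int[P]_w (g w)%:E)%E.

(* A random matrix Z in R^(m x n) is regularly varying of index alpha:
   for some norm N there is a random vector Theta on the unit sphere
   (described by its law nu) such that, for every u > 0,
   P(N Z > u x, Z / N Z \in . ) / P(N Z > x) --> u^-alpha P(Theta \in .)
   weakly (tested against bounded continuous functions). *)
Definition regvar {dT} {T : measurableType dT} (P : probability T R)
  (m n : nat) (Z : T -> 'M[R]_(m, n)) (alpha : R) : Prop :=
  exists N : 'M[R]_(m, n) -> R, is_norm N /\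
  exists nu : probability (mxB m n) R,
    nu [set z | N z = 1] = 1%E /\
    forall u : R, 0 < u -> forall g : 'M[R]_(m, n) -> R, bounded_cont g ->
      (fun x : R =>
         fine (Ex P (fun w => g ((N (Z w))^-1 *: Z w) *
                               \1_[set w' | u * x < N (Z w')] w))
         / fine (P [set w | x < N (Z w)]))
      @ +oo --> u `^ (- alpha) * fine (\int[nu]_z (g z)%:E)%E.

Definition strictly_stationary {dT} {T : measurableType dT}
  (P : probability T R) (d : nat) (X : int -> T -> 'rV[R]_d) : Prop :=
  forall (h s : int) (n : nat) (B : set 'M[R]_(n, d)), mxBorel B ->
    P [set w | window (fun t => X t w) (s + h) n \in B] =
    P [set w | window (fun t => X t w) s n \in B].

Definition jointly_regvar {dT} {T : measurableType dT}
  (P : probability T R) (d : nat) (X : int -> T -> 'rV[R]_d) (alpha : R)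
  : Prop :=
  forall k : nat, (0 < k)%N ->
    regvar P (fun w => window (fun t => X t w) 1 k) alpha.

Definition gen_sigma {T} (d : nat) (Z : int -> T -> 'rV[R]_d)
  : set (set T) :=
  <<s \bigcup_(t in [set: int]) [set Z t @^-1` B | B in mxBorel (m:=1) (n:=d)] >>.

End defs.

(* Main.v *)
(* Let p(x) = P(|X_0| > x). Conditioning on |X_0| > u x instead of |X_0| > x, the
   hypothesis on (Y_t) gives p(u x) / p(x) -> u^-alpha for every u > 0 and
     E[f(X / x); |X_0| > u x] / p(x) -> u^-alpha E f(u Y).
   For u >= 1 comparison with E[f(X / x); |X_0| > x] / p(x) -> E f(Y) yields
     E[f(Y); |Y_0| > u] = u^-alpha E f(u Y),
   which for f invariant under scaling is the independence of |Y_0| and Theta.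

   For the time change, let f >= 0 vanish for |y_0| <= eps and let h be a bounded
   continuous function vanishing on [0, 1]. Apply stationarity to
   G(y) = f(y / |y_i|) h(|y_i|): seen from time i it only charges |X_0| > x, seen
   from time 0 it only charges |X_0| > eps x, and the two limits are
     E[f(Theta_{. - i})] E[h(|Y_0|)] = eps^-alpha E[f(Theta / |Theta_i|) h(eps |Y_0| |Theta_i|)].
   By independence and the scaling identity for h the right-hand side is
   E[f(Theta / |Theta_i|) |Theta_i|^alpha] E[h(|Y_0|)]. Monotone convergence
   removes the cutoff near y_0 = 0. *)
Require Import Defs.
From HB Require Import structures.
From mathcomp Require Import all_boot all_order all_algebra.
From mathcomp Require Import all_classical all_reals all_analysis.
From mathcomp Require Import measurable_realfun.
From mathcomp Require Import ring lra zify.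
Import Order.TTheory GRing.Theory Num.Theory.
Import numFieldNormedType.Exports.
Local Open Scope classical_set_scope.
Local Open Scope ring_scope.

(** * Norms and Borel sets of matrix spaces *)

Section norm_facts.
Context {R : realType}.

Lemma is_norm0 {V : lmodType R} {N : V -> R} : is_norm N -> N 0 = 0.
Proof. by move=> [_ NZ _]; rewrite -(scale0r (0 : V)) NZ normr0 mul0r. Qed.

Lemma is_norm_ge0 {V : lmodType R} {N : V -> R} : is_norm N -> forall x, 0 <= N x.
Proof.
move=> nN x; have [ND NZ _] := nN.
have := ND x (- x); rewrite subrr (is_norm0 nN) -scaleN1r NZ normrN1 mul1r.
by rewrite -mulr2n -mulr_natl pmulr_rge0.
Qed.

Lemma is_norm_sum {V : lmodType R} {N : V -> R} (I : Type) (s : seq I) (F : I -> V) :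
  is_norm N -> N (\sum_(i <- s) F i) <= \sum_(i <- s) N (F i).
Proof.
move=> nN; have [ND _ _] := nN; elim: s => [|i s IH].
  by rewrite !big_nil (is_norm0 nN).
by rewrite !big_cons (le_trans (ND _ _))// lerD2l.
Qed.

(** Expanding a vector along the standard basis gives N x <= C |x|, with C the sum of the values of
    N on the basis vectors. By the triangle inequality N is then C-Lipschitz for the sup norm, which
    defines the topology. *)
Lemma is_norm_continuous {d : nat} {N : 'rV[R]_d -> R} :
  is_norm N -> continuous N.
Proof.
move=> nN; have [ND NZ _] := nN.
pose C : R := \sum_(j < d) N (delta_mx ord0 j).
have NC (x : 'rV[R]_d) : N x <= `|x| * C.
  rewrite [in X in X <= _](row_sum_delta x) (le_trans (is_norm_sum _ _ _ nN))//.
  rewrite mulr_sumr; apply: ler_sum => j _; rewrite NZ ler_wpM2r ?is_norm_ge0//.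
  rewrite [leRHS]/Num.Def.normr/= mx_normrE.
  by apply/bigmax_geP; right; exists (ord0, j).
have C0 : 0 <= C by apply: sumr_ge0 => j _; exact: is_norm_ge0.
have NB x y : `|N x - N y| <= `|x - y| * C.
  apply: le_trans (NC _).
  rewrite ler_distl; apply/andP; split.
    rewrite lerBlDr; have -> : N (x - y) = N (y - x).
      by rewrite -(opprB y x) -scaleN1r NZ normrN1 mul1r.
    by apply: le_trans (ND _ _); rewrite addrC subrK.
  by apply: le_trans (ND _ _); rewrite addrC subrK.
move=> x; apply/(@cvgrPdist_le _ _ _ (nbhs x) (nbhs_filter x)) => e e0.
near=> y; rewrite (le_trans (NB _ _))//.
(* [C + 1] replaces [C] so that the divisor is positive even for d = 0. *)
apply: (@le_trans _ _ (`|x - y| * (C + 1))).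
  by rewrite ler_wpM2l// lerDl.
rewrite -ler_pdivlMr ?ltr_wpDl//.
near: y; apply/nbhs_ballP; exists (e / (C + 1)) => [|z].
  by rewrite /= divr_gt0// ltr_wpDl.
by rewrite mx_norm_ball => /ltW.
Unshelve. all: by end_near. Qed.

End norm_facts.

Section matrix_facts.
Context {R : realType}.

Lemma mx_continuous {T : topologicalType} (m n : nat) (f : T -> 'M[R]_(m, n)) :
  (forall i j, continuous (fun x => f x i j)) -> continuous f.
Proof.
move=> cf x A [P nP sPA]; apply: (@filterS _ _ _ [set y | forall i j, P i j (f y i j)]).
  by move=> y Py; exact: sPA.
apply: filter_forall => i; apply: filter_forall => j.
exact: (cf i j x _ (nP i j)).
Qed.

Lemma rowsub_continuous (m m' n : nat) (g : 'I_m' -> 'I_m) :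
  continuous (rowsub g : 'M[R]_(m, n) -> 'M[R]_(m', n)).
Proof.
apply: mx_continuous => i j.
rewrite (_ : (fun _ => _) = (fun A : 'M[R]_(m, n) => A (g i) j)).
  exact: coord_continuous.
by apply/funext => A; rewrite !mxE.
Qed.

Lemma row_continuous (m n : nat) (k : 'I_m) :
  continuous (row k : 'M[R]_(m, n) -> 'rV[R]_n).
Proof.
apply: mx_continuous => i j.
rewrite (_ : (fun _ => _) = (fun A : 'M[R]_(m, n) => A k j)).
  exact: coord_continuous.
by apply/funext => A; rewrite !mxE.
Qed.

Lemma mxBorel_open (m n : nat) (U : set 'M[R]_(m, n)) : open U -> mxBorel U.
Proof. by move=> oU; exact: sub_sigma_algebra. Qed.

Lemma continuous_mxB_measurable (m n : nat) (f : 'M[R]_(m, n) -> R) :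
  continuous f -> measurable_fun setT (f : @mxB R m n -> R).
Proof.
move=> /continuousP cf; apply: (measurability _ (RGenOpens.measurableE R)).
move=> _ [_ [a [b ->] <-]]; rewrite setTI; apply: mxBorel_open.
exact/cf/interval_open.
Qed.

Context {dT : measure_display} {T : measurableType dT}.

Lemma rand_mxP (m n : nat) (Z : T -> 'M[R]_(m, n)) :
  rand_mx Z <-> measurable_fun setT (Z : T -> @mxB R m n).
Proof.
split=> [rZ _ B mB|mZ B mB]; first by rewrite setTI; exact: rZ.
by rewrite -[X in measurable X]setTI; exact: mZ.
Qed.

Lemma rand_mx_comp_continuous {m n : nat} {Z : T -> 'M[R]_(m, n)}
    {f : 'M[R]_(m, n) -> R} :
  rand_mx Z -> continuous f -> measurable_fun setT (f \o Z).
Proof.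
move=> /rand_mxP mZ cf; exact: (measurableT_comp (continuous_mxB_measurable _ _ _ cf)).
Qed.

Lemma rand_mx_comp {m n m' n' : nat} {Z : T -> 'M[R]_(m, n)}
    {f : 'M[R]_(m, n) -> 'M[R]_(m', n')} :
  rand_mx Z -> continuous f -> rand_mx (f \o Z).
Proof.
move=> rZ /continuousP cf B.
apply: (@smallest_sub _ _ _ [set B | measurable ((f \o Z) @^-1` B)]).
- split=> /= [|A mA|F mF]; first by rewrite preimage_set0.
  + by rewrite setTD preimage_setC; exact: measurableC.
  + by rewrite preimage_bigcup; exact: bigcupT_measurable.
- by move=> U oU /=; rewrite comp_preimage; exact: rZ (mxBorel_open _ _ _ (cf _ oU)).
Qed.

(* Every open set is a countable union of balls with rational centers and radii [k^-1]. *)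
Lemma rand_mx_entries (m n : nat) (Z : T -> 'M[R]_(m, n)) :
  (forall i j, measurable_fun setT (fun w => Z w i j)) -> rand_mx Z.
Proof.
move=> mZ B.
apply: (@smallest_sub _ _ _ [set B | measurable (Z @^-1` B)]).
  split=> /= [|A mA|F mF]; first by rewrite preimage_set0.
  - by rewrite setTD preimage_setC; exact: measurableC.
  - by rewrite preimage_bigcup; exact: bigcupT_measurable.
move=> U oU /=.
pose box (q : 'M[rat]_(m, n) * nat) : set 'M[R]_(m, n) :=
  [set z | forall i j, `|ratr (q.1 i j) - z i j| < q.2.+1%:R^-1].
(* Boxes that leave [U] contribute the empty set, so the union runs over the whole countable index
   type. *)
pose F q := if `[< box q `<=` U >] then Z @^-1` box q else set0.
have -> : Z @^-1` U = \bigcup_q F q.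
  apply/seteqP; split=> [w Uw|w [q _]]; last first.
    by rewrite /F; case: asboolP => // qU /qU.
  have /nbhs_ballP[e /= e0 eU] : nbhs (Z w) U by exact: open_nbhs_nbhs.
  have [k ke] : exists k : nat, k.+1%:R^-1 < e / 2.
    have /cvgrPdist_lt/(_ (e / 2)) := @cvg_harmonic R.
    rewrite divr_gt0// => /(_ isT)[k _ /(_ k (leqnn k))] /=.
    by rewrite sub0r normrN ger0_norm//; exists k.
  have qP i j : exists q : rat, `|ratr q - Z w i j| < k.+1%:R^-1.
    have : Z w i j - k.+1%:R^-1 < Z w i j + k.+1%:R^-1.
      by rewrite ltrBlDr -addrA ltrDl addr_gt0.
    move=> /rat_in_itvoo[q]; rewrite in_itv/= => qk; exists q.
    by rewrite ltr_distl.
  pose q : 'M[rat]_(m, n) := \matrix_(i, j) projT1 (cid (qP i j)).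
  have qE i j : `|ratr (q i j) - Z w i j| < k.+1%:R^-1.
    by rewrite mxE; exact: projT2 (cid (qP i j)).
  exists (q, k) => //; rewrite /F; case: asboolP => //= -[] z zq; apply: eU.
  split=> // i j; rewrite /ball/= (splitr e) -[X in `|X|](subrKA (ratr (q i j))).
  rewrite (le_lt_trans (ler_normD _ _))// ltrD//.
    by rewrite distrC (lt_trans (qE i j)).
  exact: lt_trans (zq i j) ke.
apply: countable_bigcupT_measurable => // q.
rewrite /F; case: asboolP => // _.
have -> : Z @^-1` box q = \bigcap_(ij in [set: 'I_m * 'I_n])
    [set w | `|ratr (q.1 ij.1 ij.2) - Z w ij.1 ij.2| < q.2.+1%:R^-1].
  by apply/seteqP; split=> [w bw [i j] _ //=|w bw i j]; exact: (bw (i, j)).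
apply: fin_bigcap_measurable => // -[i j] _ /=.
rewrite -[X in measurable X]setTI.
apply: (measurable_fun_ltr (f := fun w => `|ratr (q.1 i j) - Z w i j|)) => //.
apply: measurableT_comp => //; apply: measurable_funB => //.
Qed.

Lemma rand_mx_coord (m n : nat) (Z : T -> 'M[R]_(m, n)) i j :
  rand_mx Z -> measurable_fun setT (fun w => Z w i j).
Proof. by move=> rZ; exact: (rand_mx_comp_continuous rZ (@coord_continuous _ _ _ i j)). Qed.

Lemma rand_mx_window (d : nat) (Z : int -> T -> 'rV[R]_d) (s : int) (n : nat) :
  (forall t, rand_mx (Z t)) -> rand_mx (fun w => window (fun t => Z t w) s n).
Proof.
move=> rZ; apply: rand_mx_entries => i j.
under eq_fun do rewrite mxE.
exact: rand_mx_coord.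
Qed.

End matrix_facts.

(** * Integrals of bounded measurable functions *)

Section clamp.
Context {R : realType}.

(** Truncation to [0, 1]. For a < b, [clamp ((r - a) / (b - a))] is a continuous ramp from 0 at a to
    1 at b; such ramps stand in for indicators of r > a, since weak convergence tests only
    continuous functions. *)
Definition clamp (t : R) : R := Num.min 1 (Num.max 0 t).

Lemma clamp_ge0 t : 0 <= clamp t.
Proof. by rewrite /clamp le_min ler01 le_max lexx. Qed.

Lemma clamp_le1 t : clamp t <= 1.
Proof. by rewrite /clamp ge_min lexx. Qed.

Lemma clamp0 t : t <= 0 -> clamp t = 0.
Proof. by move=> t0; rewrite /clamp max_l// min_r. Qed.

Lemma clamp1 t : 1 <= t -> clamp t = 1.
Proof. by move=> t1; rewrite /clamp max_r ?(le_trans ler01)// min_l. Qed.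

Lemma clamp_homo : {homo clamp : s t / s <= t}.
Proof.
move=> s t st; rewrite /clamp le_min ge_min lexx/= ge_min.
apply/orP; right; rewrite ge_max le_max lexx/= le_max st orbT //.
Qed.

Lemma clamp_continuous : continuous clamp.
Proof.
have -> : clamp = (fun=> 1) \min ((fun=> 0) \max id) by [].
move=> x; apply: continuous_min; first exact: cvg_cst.
by apply: continuous_max; [exact: cvg_cst|exact: cvg_id].
Qed.

Lemma clamp_norm_le1 t : `|clamp t| <= 1.
Proof. by rewrite ger0_norm ?clamp_ge0 ?clamp_le1. Qed.

End clamp.

Section integrals.
Context {R : realType}.

(** With D the distance to the complement of [U], the functions [clamp (k%:R * D z)] increase with
    k; they are 0 off [U] and become 1 at a point of [U] once k >= 1 / D z. *)
Lemma open_indic_approx {V : normedModType R} (U : set V) : open U ->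
  exists f : nat -> V -> R,
  [/\ forall k, continuous (f k), forall k z, 0 <= f k z <= 1,
      forall z, {homo f ^~ z : k l / (k <= l)%N >-> k <= l}
    & forall z, \forall k \near \oo, f k z = \1_U z].
Proof.
move=> oU; have [UT|/eqP/set0P[c0 c0U]] := pselect (~` U = set0).
  have {}UT : U = setT by rewrite -[U]setCK UT setC0.
  exists (fun _ _ => 1); split=> //.
  - by move=> k z; exact: cvg_cst.
  - by move=> k z; rewrite ler01 lexx.
  - by move=> z k l _; exact: lexx.
  - by move=> z; apply: nearW => k; rewrite UT indicT.
pose S z := [set `|z - c| | c in ~` U].
pose D z := inf (S z).
have S0 z : S z !=set0 by exists `|z - c0|; exists c0.
have Slb z : lbound (S z) 0 by move=> _ [c _ <-].
have Sinf z : has_inf (S z) by split=> //; exists 0.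
have D0 z : 0 <= D z by exact: (lb_le_inf (S0 z) (Slb z)).
have Dlip y z : D y <= `|y - z| + D z.
  rewrite addrC -lerBlDr; apply: lb_le_inf => // _ [c cU <-].
  rewrite lerBlDr; apply: (@le_trans _ _ `|y - c|).
    by apply: ge_inf; [exact: (Sinf y).2|exists c].
  by rewrite [leRHS]addrC -[y - c](subrKA z) ler_normD.
have DC z : ~ U z -> D z = 0.
  move=> Uz; apply/eqP; rewrite eq_le D0 andbT.
  by apply: ge_inf; [exact: (Sinf z).2|exists z => //; rewrite subrr normr0].
have DU z : U z -> 0 < D z.
  move=> Uz; have /nbhs_normP[e /= e0 eU] : nbhs z U by exact: open_nbhs_nbhs.
  apply: (lt_le_trans e0); apply: lb_le_inf => // _ [c cU <-].
  by rewrite leNgt; apply/negP => ce; apply: cU; exact: eU.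
have Dcont : continuous D.
  move=> x; apply/cvgrPdist_le => e e0; near=> y.
  have xye : `|x - y| <= e.
    by near: y; apply/nbhs_normP; exists e => // y /ltW.
  rewrite ler_distl; apply/andP; split.
    by rewrite lerBlDr; apply: le_trans (Dlip y x) _; rewrite distrC [leLHS]addrC lerD2l.
  by apply: le_trans (Dlip x y) _; rewrite [leLHS]addrC lerD2l.
exists (fun k z => clamp (k%:R * D z)); split.
- move=> k z; apply: continuous_cvg; first exact: clamp_continuous.
  by apply: cvgM; [exact: cvg_cst|exact: Dcont].
- by move=> k z; rewrite clamp_ge0 clamp_le1.
- by move=> z k l kl; apply: clamp_homo; rewrite ler_wpM2r// ler_nat.
- move=> z; have [Uz|Uz] := pselect (U z); last first.
    by near=> k; rewrite DC// mulr0 clamp0// indicE memNset.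
  near=> k; rewrite indicE mem_set// clamp1// -ler_pdivrMr ?DU// div1r.
  by near: k; exact: nbhs_infty_ger.
Unshelve. all: by end_near. Qed.

Lemma bounded_integrable {dT : measure_display} {T : measurableType dT}
    (P : {measure set T -> \bar R}) {g : T -> R} (M : R) :
  (P setT < +oo)%E -> measurable_fun setT g -> (forall w, `|g w| <= M) ->
  P.-integrable setT (EFin \o g).
Proof.
move=> Poo mg gM; apply: measurable_bounded_integrable => //.
by exists M; split; [exact: num_real|move=> x Mx w _; exact: le_trans (gM w) (ltW Mx)].
Qed.

End integrals.

Section bounded_measurable.
Context {R : realType} {dT : measure_display} {T : measurableType dT}.
Context (P : probability T R).
Implicit Types (g h : T -> R) (A : set T).

Definition bmeas g := measurable_fun setT g /\ exists M : R, forall w, `|g w| <= M.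

Lemma bmeas_integrable {g} : bmeas g -> P.-integrable setT (EFin \o g).
Proof.
move=> [mg [M gM]]; apply: (bounded_integrable P M) => //.
exact: le_lt_trans (probability_le1 P measurableT) (ltry _).
Qed.

Lemma bmeas_cst (c : R) : bmeas (fun=> c).
Proof. by split; [exact: measurable_cst|exists `|c|]. Qed.

Lemma bmeasD g h : bmeas g -> bmeas h -> bmeas (fun w => g w + h w).
Proof.
move=> [mg [M gM]] [mh [N hN]]; split; first exact: measurable_funD.
by exists (M + N) => w; rewrite (le_trans (ler_normD _ _))// lerD.
Qed.

Lemma bmeasM g h : bmeas g -> bmeas h -> bmeas (fun w => g w * h w).
Proof.
move=> [mg [M gM]] [mh [N hN]]; split; first exact: measurable_funM.
by exists (M * N) => w; rewrite normrM ler_pM.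
Qed.

Lemma bmeasZ (c : R) g : bmeas g -> bmeas (fun w => c * g w).
Proof. by move=> bg; apply: bmeasM => //; exact: bmeas_cst. Qed.

Lemma bmeasB g h : bmeas g -> bmeas h -> bmeas (fun w => g w - h w).
Proof.
move=> [mg [M gM]] [mh [N hN]]; split; first exact: measurable_funB.
by exists (M + N) => w; rewrite (le_trans (ler_normB _ _))// lerD.
Qed.

Lemma bmeas_indic {A} : measurable A -> bmeas (\1_A : T -> R).
Proof.
move=> mA; split; first exact: measurable_indic.
by exists 1 => w; rewrite indicE; case: (_ \in _); rewrite ?normr1 ?normr0.
Qed.

Lemma RI_le g h : bmeas g -> bmeas h -> (forall w, g w <= h w) ->
  \int[P]_w g w <= \int[P]_w h w.
Proof. by move=> bg bh gh; apply: le_Rintegral => //; exact: bmeas_integrable. Qed.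

Lemma RI_D g h : bmeas g -> bmeas h ->
  \int[P]_w (g w + h w) = \int[P]_w g w + \int[P]_w h w.
Proof. by move=> bg bh; apply: RintegralD => //; exact: bmeas_integrable. Qed.

Lemma RI_B g h : bmeas g -> bmeas h ->
  \int[P]_w (g w - h w) = \int[P]_w g w - \int[P]_w h w.
Proof. by move=> bg bh; apply: RintegralB => //; exact: bmeas_integrable. Qed.

Lemma RI_Z (c : R) g : bmeas g -> \int[P]_w (c * g w) = c * \int[P]_w g w.
Proof. by move=> bg; apply: RintegralZl => //; exact: bmeas_integrable. Qed.

Lemma RI_cst (c : R) : \int[P]_w c = c.
Proof. by rewrite Rintegral_cst// [X in fine X](@probability_setT _ _ _ P) mulr1. Qed.

Lemma RI_indic A : measurable A -> \int[P]_w (\1_A w : R) = fine (P A).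
Proof. by move=> mA; rewrite /Rintegral integral_indic// setIT. Qed.

(** Later applied with the almost sure event |Y_0| > 1, on which the normalization by max(|Y_0|, 1)
    coincides with the one by |Y_0|. *)
Lemma RI_full A g h : measurable A -> P A = 1%E -> bmeas g -> bmeas h ->
  (forall w, A w -> g w = h w) -> \int[P]_w g w = \int[P]_w h w.
Proof.
move=> mA PA bg bh gh; congr fine; apply: ae_eq_integral => //.
- by apply/measurable_EFinP; case: bg.
- by apply/measurable_EFinP; case: bh.
exists (~` A); split; first exact: measurableC.
  by have := probability_setC P mA; rewrite PA subee.

by move=> w /= ngh Aw; apply: ngh => _; rewrite gh.
Qed.

Lemma bmeas_EFin g : bmeas g -> (\int[P]_w g w)%:E = (\int[P]_w (g w)%:E)%E.
Proof.
by move=> bg; rewrite /Rintegral fineK//; apply: integrable_fin_num => //; exact: bmeas_integrable.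
Qed.

End bounded_measurable.

Section bounded_continuous.
Context {R : realType}.

Lemma bcont_comp {m n m' n' : nat} {f : 'M[R]_(m, n) -> R}
    {phi : 'M[R]_(m', n') -> 'M[R]_(m, n)} :
  bounded_cont f -> continuous phi -> bounded_cont (f \o phi).
Proof.
move=> [cf [M fM]] cphi; split; last by exists M => z; exact: fM.
by move=> z; apply: continuous_comp; [exact: cphi|exact: cf].
Qed.

Lemma bcont_scale {m n : nat} {f : 'M[R]_(m, n) -> R} (c : R) :
  bounded_cont f -> bounded_cont (fun z => f (c *: z)).
Proof. by move=> bf; apply: (bcont_comp bf); exact: scaler_continuous. Qed.

Lemma bcont_mul {m n : nat} {f g : 'M[R]_(m, n) -> R} :
  bounded_cont f -> bounded_cont g -> bounded_cont (fun z => f z * g z).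
Proof.
move=> [cf [M fM]] [cg [N gN]]; split; last first.
  by exists (M * N) => z; rewrite normrM ler_pM.
by move=> z; exact: (cvgM (cf z) (cg z)).
Qed.

Lemma bcont_cst {m n : nat} (c : R) : bounded_cont (fun _ : 'M[R]_(m, n) => c).
Proof. by split; [exact: cst_continuous|exists `|c|]. Qed.

Lemma bcont_clamp {m n : nat} {g : 'M[R]_(m, n) -> R} :
  continuous g -> bounded_cont (fun z => clamp (g z)).
Proof.
move=> cg; split; last by exists 1 => z; exact: clamp_norm_le1.
by move=> z; apply: continuous_comp; [exact: cg|exact: clamp_continuous].
Qed.

Lemma bmeas_bcont {dT : measure_display} {T : measurableType dT} {m n : nat}
    {f : 'M[R]_(m, n) -> R} {Z : T -> 'M[R]_(m, n)} :
  rand_mx Z -> bounded_cont f -> bmeas (fun w => f (Z w)).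
Proof.
move=> rZ [cf [M fM]]; split; last by exists M.
exact: (rand_mx_comp_continuous rZ cf).
Qed.

Lemma row_window {d : nat} (Z : int -> 'rV[R]_d) (s : int) (n : nat) (k : 'I_n) :
  row k (window Z s n) = Z (s + (k : nat)%:Z).
Proof. by apply/rowP => j; rewrite !mxE. Qed.

Lemma window_scale {d : nat} (c : R) (Z : int -> 'rV[R]_d) (s : int) (n : nat) :
  window (fun t => c *: Z t) s n = c *: window Z s n.
Proof. by apply/matrixP => i j; rewrite !mxE. Qed.

Lemma powR_cvg (a u : R) : 0 < u -> x `^ a @[x --> u] --> u `^ a.
Proof.
move=> u0; have u0i : u \in `]0, +oo[ by rewrite in_itv/= u0.
have /derivable1_diffP := @derivable_powR R 1 a u u0i.
exact: differentiable_continuous.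
Qed.

End bounded_continuous.

(** * Measures determined by continuous functions, and integration under independence *)

Section weak_determination.
Context {R : realType} {dT : measure_display} {T : measurableType dT}.
Context (P : probability T R).

(** Both sides are finite measures in [B]. They agree on open sets, whose indicators are increasing
    limits of continuous functions, and the open sets form a generating class closed under
    intersection. *)
Lemma mxBorel_proportional {m n : nat} (Z : T -> 'M[R]_(m, n)) (A : set T) (c : R) :
  rand_mx Z -> measurable A -> 0 <= c ->
  (forall f : 'M[R]_(m, n) -> R, continuous f -> (forall z, 0 <= f z <= 1) ->
    \int[P]_w (f (Z w) * \1_A w) = c * \int[P]_w f (Z w)) ->
  forall B, mxBorel B -> P (Z @^-1` B `&` A) = (c%:E * P (Z @^-1` B))%E.
Proof.
move=> rZ mA c0 fcP.
have mZ : measurable_fun setT (Z : T -> @mxB R m n) by exact/rand_mxP.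
pose Zm : {mfun T >-> @mxB R m n} := mfun_Sub (mem_set mZ).
pose m1f : {measure set (@mxB R m n) -> \bar R} := pushforward (mrestr P mA) Zm.
pose m1 := m1f mZ.
pose m2 : {measure set (@mxB R m n) -> \bar R} :=
  mscale (NngNum c0) (distribution P Zm).
move=> B mB; rewrite -[LHS]/(m1 B) -[RHS]/(m2 B).
apply: (@measure_unique _ R (@mxB R m n) (@open 'M[R]_(m, n)) (fun=> setT)
  _ _ _ _ m1 m2 _ _ B) => //.
- by move=> C D; exact: openI.
- by move=> _; exact: openT.
- by apply/seteqP; split=> // z _; exists 0%N.
- move=> U oU; have [f [fc f01 fh fU]] := open_indic_approx U oU.
  have bf k : bounded_cont (f k).
    by split=> //; exists 1 => z; case/andP: (f01 k z) => f0 ?; rewrite ger0_norm.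
  have mU : measurable (Z @^-1` U) by exact: rZ (mxBorel_open _ _ _ oU).
  (* Used with [C := A] and [C := setT], the two sides of the assumed identity. *)
  have lim (C : set T) : measurable C ->
      (\int[P]_w (f k (Z w) * \1_C w)%:E)%E @[k --> \oo] --> P (Z @^-1` U `&` C).
    move=> mC; rewrite -[Z @^-1` U `&` C]setIT -integral_indic//; last exact: measurableI.
    have -> : (\int[P]_w (\1_(Z @^-1` U `&` C) w)%:E =
        \int[P]_w (limn (fun k => (f k (Z w) * \1_C w)%:E)))%E.
      apply: eq_integral => w _; apply/esym/cvg_lim => //.
      apply: cvg_near_cst; move: (fU (Z w)); apply: filterS => k /= ->.
      by rewrite indicI.
    apply: cvg_monotone_convergence => //.
    + move=> k; apply/measurable_EFinP; apply: (bmeasM _ _ _ (bmeas_indic mC)).1.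
      exact: bmeas_bcont.
    + by move=> k w _; rewrite lee_fin mulr_ge0//; case/andP: (f01 k (Z w)).
    + by move=> w _ k l kl; rewrite lee_fin ler_wpM2r//; exact: fh.
  apply/esym; rewrite -[LHS]/(c%:E * P (Z @^-1` U))%E -[RHS]/(P (Z @^-1` U `&` A)).
  apply/esym; rewrite -[X in (_ * P X)%E]setIT.
  apply: (cvg_unique _ (lim A mA)) => //.
  have := cvgeZl (_ : c%:E \is a fin_num) (lim setT measurableT).
  move=> /(_ isT); apply: cvg_trans; apply: near_eq_cvg; apply: nearW => k.
  have bfk : bmeas (fun w => f k (Z w)) by exact: bmeas_bcont.
  rewrite -!(bmeas_EFin P) -?EFinM.
  + rewrite fcP//; congr (_ * _)%:E; apply: eq_Rintegral => w _.
    by rewrite indicT mulr1.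
  + by apply: bmeasM => //; exact: bmeas_indic.
  + by apply: bmeasM => //; exact: bmeas_indic.
- move=> k; rewrite -[m1 _]/(P (setT `&` A)).
  exact: le_lt_trans (probability_le1 P (measurableI _ _ measurableT mA)) (ltry _).
Qed.

(** The product formula on rectangles identifies the joint law of [Z1] and [Z2] with the product of
    their laws; Tonelli then integrates out one variable after the other. *)
Lemma indep_integral {d1 d2 : measure_display} {T1 : measurableType d1}
    {T2 : measurableType d2} (Z1 : T -> T1) (Z2 : T -> T2) (Phi : T1 * T2 -> \bar R) :
  measurable_fun setT Z1 -> measurable_fun setT Z2 ->
  (forall A B, measurable A -> measurable B ->
    P (Z1 @^-1` A `&` Z2 @^-1` B) = (P (Z1 @^-1` A) * P (Z2 @^-1` B))%E) ->
  measurable_fun setT Phi -> (forall z, 0 <= Phi z)%E ->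
  (\int[P]_w Phi (Z1 w, Z2 w) = \int[P]_w \int[P]_w' Phi (Z1 w, Z2 w'))%E.
Proof.
move=> mZ1 mZ2 ind mPhi Phi0.
pose X1 : {mfun T >-> T1} := mfun_Sub (mem_set mZ1).
pose X2 : {mfun T >-> T2} := mfun_Sub (mem_set mZ2).
pose Q1 := distribution P X1; pose Q2 := distribution P X2.
have mZ : measurable_fun setT (fun w => (Z1 w, Z2 w)) by exact: measurable_fun_pair.
pose Q : {measure set (T1 * T2) -> \bar R} :=
  distribution P (mfun_Sub (mem_set mZ) : {mfun T >-> (T1 * T2)%type}).
have QE : forall A, measurable A -> (Q1 \x Q2)%E A = Q A.
  by apply: product_measure_unique => A B mA mB; exact: ind.
transitivity (\int[Q]_z Phi z)%E.
  by rewrite (ge0_integral_pushforward mZ P measurableT mPhi).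
rewrite -(eq_measure_integral Q (fun A mA _ => QE A mA)) fubini_tonelli1//.
rewrite (ge0_integral_pushforward mZ1 P measurableT)//; last 2 first.
- exact: measurable_fun_fubini_tonelli_F.
- by move=> x _; apply: integral_ge0 => y _.
apply: eq_integral => w _ /=; rewrite /fubini_F.
rewrite (ge0_integral_pushforward mZ2 P measurableT)//.
exact: (measurableT_comp mPhi (pair1_measurable (Z1 w))).
Qed.

End weak_determination.

(** The longer window has size [n'.+1] because [inord] needs an inhabited ordinal; the two
    inequalities keep the row indices in range. *)
Lemma window_sub {R : realType} {d : nat} (Z : int -> 'rV[R]_d) (s s' : int) (n n' : nat) :
  s' <= s -> s + n%:Z <= s' + n'.+1%:Z ->
  window Z s n =
  rowsub (fun i : 'I_n => inord (`|s - s'|%N + i) : 'I_n'.+1) (window Z s' n'.+1).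
Proof.
move=> ss' sn; apply/matrixP => i j; rewrite !mxE.
have ? := ltn_ord i.
by rewrite inordK; [congr (Z _ _ _); lia|lia].
Qed.

Lemma mxBorel_preimage {R : realType} {m n m' n' : nat}
    {f : 'M[R]_(m, n) -> 'M[R]_(m', n')} {B : set 'M[R]_(m', n')} :
  continuous f -> mxBorel B -> mxBorel (f @^-1` B).
Proof.
move=> cf mB.
exact: (@rand_mx_comp R _ (@mxB R m n) m n m' n' id f (fun _ mC => mC) cf B mB).
Qed.

Lemma scale_shift_continuous {R : realType} {V : topologicalType} {g : V -> R} (c a : R) :
  continuous g -> continuous (fun z => c * g z - a).
Proof.
by move=> cg z; exact: (cvgB (cvgM (cvg_cst c) (cg z)) (cvg_cst a)).
Qed.

(** * Scaling and independence for the tail process *)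

Lemma measurable_gt {R : realType} {dT : measure_display} {T : measurableType dT}
  (g : T -> R) (u : R) : measurable_fun setT g -> measurable [set w | u < g w].
Proof.
move=> mg; rewrite -[X in measurable X]setTI.
exact: (measurable_fun_ltr (measurable_cst _) mg).
Qed.

Lemma affine_continuous {R : realType} {V : topologicalType} {g : V -> R} (a c : R) :
  continuous g -> continuous (fun z => (g z - a) / c).
Proof.
by move=> cg z; exact: (cvgM (cvgB (cg z) (cvg_cst a)) (cvg_cst c^-1)).
Qed.

Lemma row_norm_continuous {R : realType} {n d : nat} {N : 'rV[R]_d -> R} (k : 'I_n) :
  is_norm N -> continuous (fun z : 'M[R]_(n, d) => N (row k z)).
Proof.
move=> nN z; exact: (continuous_comp (@row_continuous _ _ _ k z)
  (is_norm_continuous nN (row k z))).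
Qed.

Lemma row_normZ {R : realType} {q d : nat} {N : 'rV[R]_d -> R} (nN : is_norm N)
  (k : 'I_q) (c : R) (z : 'M[R]_(q, d)) : N (row k (c *: z)) = `|c| * N (row k z).
Proof.
have [_ NZ _] := nN; rewrite -NZ; congr N.
by apply/rowP => j; rewrite !mxE.
Qed.

Lemma measurable_nrm {R : realType} {d : nat} {N : 'rV[R]_d -> R} (nN : is_norm N)
  {d0 : measure_display} {T0 : measurableType d0} (Z : T0 -> 'rV[R]_d) :
  rand_mx Z -> measurable_fun setT (N \o Z).
Proof. by move=> rZ; apply: rand_mx_comp_continuous => //; exact: is_norm_continuous. Qed.

(* [r^-1 = r `^ (-1)] also at [r = 0], where both sides are [0]. *)
Lemma rand_mx_normalize {R : realType} {d : nat} {N : 'rV[R]_d -> R} (nN : is_norm N)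
  {d0 : measure_display} {T0 : measurableType d0} {a b : nat}
  (Z : T0 -> 'rV[R]_d) (W : T0 -> 'M[R]_(a, b)) :
  rand_mx Z -> rand_mx W -> rand_mx (fun w => (N (Z w))^-1 *: W w).
Proof.
move=> rZ rW; apply: rand_mx_entries => i j.
under eq_fun do rewrite mxE -powR_inv1 ?is_norm_ge0//.
apply: measurable_funM; last exact: rand_mx_coord.
exact: (measurableT_comp (@measurable_powR R (-1)) (measurable_nrm nN _ rZ)).
Qed.

Section tail_process.
Context {R : realType} {d : nat} {alpha : R}
  {dT : measure_display} {T : measurableType dT} {P : probability T R}
  {X : int -> T -> 'rV[R]_d} {nrm : 'rV[R]_d -> R}
  {dT' : measure_display} {T' : measurableType dT'} {P' : probability T' R}
  {Y : int -> T' -> 'rV[R]_d}.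
Hypotheses (alpha_gt0 : 0 < alpha)
  (rX : forall t, rand_mx (X t))
  (stat : strictly_stationary P X)
  (nN : is_norm nrm)
  (rY : forall t, rand_mx (Y t))
  (Ytail : forall y : R, 1 <= y ->
     P' [set w | y < nrm (Y 0%Z w)] = (y `^ (- alpha))%:E)
  (XY : forall (s : int) (n : nat) (f : 'M[R]_(n.+1, d) -> R), bounded_cont f ->
     (fun x : R =>
        fine (Ex P (fun w => f (x^-1 *: window (fun t => X t w) s n.+1) *
                             \1_[set w' | x < nrm (X 0%Z w')] w))
        / fine (P [set w | x < nrm (X 0%Z w)]))
     @ +oo --> fine (Ex P' (fun w => f (window (fun t => Y t w) s n.+1)))).

(** * Tail probabilities of |X_0| and |Y_0| *)

Let p (x : R) : R := fine (P [set w | x < nrm (X 0%Z w)]).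
Let ind (x : R) (w : T) : R := \1_[set w' | x < nrm (X 0%Z w')] w.
Let indY (x : R) (w : T') : R := \1_[set w' | x < nrm (Y 0%Z w')] w.
Let WX s n w : 'M[R]_(n, d) := window (fun t => X t w) s n.
Let WY s n w : 'M[R]_(n, d) := window (fun t => Y t w) s n.

Let mX x : measurable [set w | x < nrm (X 0%Z w)].
Proof. exact: (measurable_gt _ _ (measurable_nrm nN _ (rX 0))). Qed.

Let mY x : measurable [set w | x < nrm (Y 0%Z w)].
Proof. exact: (measurable_gt _ _ (measurable_nrm nN _ (rY 0))). Qed.

Let bind x : bmeas (ind x). Proof. exact: bmeas_indic. Qed.
Let bindY x : bmeas (indY x). Proof. exact: bmeas_indic. Qed.

Let indE x w : ind x w = (x < nrm (X 0%Z w))%R%:R.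
Proof. by rewrite /ind indicE; congr (nat_of_bool _)%:R; apply/idP/idP; rewrite inE. Qed.

Let indYE x w : indY x w = (x < nrm (Y 0%Z w))%R%:R.
Proof. by rewrite /indY indicE; congr (nat_of_bool _)%:R; apply/idP/idP; rewrite inE. Qed.

Let pE x : p x = \int[P]_w ind x w.
Proof. by rewrite RI_indic. Qed.

Let qE y : 1 <= y -> \int[P']_w indY y w = y `^ (- alpha).
Proof. by move=> y1; rewrite RI_indic// Ytail. Qed.

(** For y < 1 a probability is at most 1 <= y^-alpha. This covers levels slightly below 1 in the
    limit of the tail ratios. *)
Let q_le y : 0 < y -> \int[P']_w indY y w <= y `^ (- alpha).
Proof.
move=> y0; have [y1|y1] := leP 1 y; first by rewrite qE.
apply: (@le_trans _ _ 1).
  rewrite -[leRHS](RI_cst P'); apply: RI_le => //; first exact: bmeas_cst.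
  by move=> w; rewrite indYE; case: (_ < _).
rewrite powRN -[leLHS]invr1 lef_pV2 ?posrE ?powR_gt0//.
have : y `^ alpha <= 1 `^ alpha by rewrite ge0_ler_powR// ?nnegrE ?ltW.
by rewrite powR1.
Qed.

Let bWX s n (f : 'M[R]_(n, d) -> R) c : bounded_cont f ->
  bmeas (fun w => f (c *: WX s n w)).
Proof.
by move=> bf; exact: (bmeas_bcont (rand_mx_window _ _ _ _ rX) (bcont_scale c bf)).
Qed.

Let bWY s n (f : 'M[R]_(n, d) -> R) : bounded_cont f ->
  bmeas (fun w => f (WY s n w)).
Proof. by move=> bf; exact: (bmeas_bcont (rand_mx_window _ _ _ _ rY) bf). Qed.

Let bWYZ s n (f : 'M[R]_(n, d) -> R) c : bounded_cont f ->
  bmeas (fun w => f (c *: WY s n w)).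
Proof.
by move=> bf; exact: (bmeas_bcont (rand_mx_window _ _ _ _ rY) (bcont_scale c bf)).
Qed.

Let cvgXY s n (f : 'M[R]_(n.+1, d) -> R) : bounded_cont f ->
  (\int[P]_w (f (x^-1 *: WX s n.+1 w) * ind x w) / p x) @[x --> +oo]
    --> \int[P']_w f (WY s n.+1 w).
Proof. exact: XY. Qed.

(** For f = 1 the conditional expectation tends to 1, whereas the convention [0^-1 = 0] would make
    it 0 wherever p vanishes. *)
Let p_neq0 : \forall x \near +oo, p x != 0.
Proof.
have := cvgXY 0 0 _ (bcont_cst 1).
rewrite RI_cst => /cvgrPdist_lt/(_ 1 ltr01); apply: filterS => x.
by apply: contraTneq => ->; rewrite invr0 mulr0 subr0 normr1 ltxx.
Qed.

Let p_ge0 x : 0 <= p x. Proof. exact: fine_ge0. Qed.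

Let p_gt0 : \forall x \near +oo, 0 < p x.
Proof. by move: p_neq0; apply: filterS => x p0; rewrite lt_neqAle eq_sym p0 p_ge0. Qed.

Let cvg_clamp (a b : R) : a < b ->
  (\int[P]_w (clamp ((nrm (X 0%Z w) / x - a) / (b - a)) * ind x w) / p x) @[x --> +oo]
    --> \int[P']_w clamp ((nrm (Y 0%Z w) - a) / (b - a)).
Proof.
move=> ab; pose f (z : 'M[R]_(1, d)) := clamp ((nrm (row ord0 z) - a) / (b - a)).
have bf : bounded_cont f.
  exact/bcont_clamp/affine_continuous/row_norm_continuous.
have -> : \int[P']_w clamp ((nrm (Y 0%Z w) - a) / (b - a)) = \int[P']_w f (WY 0 1 w).
  by apply: eq_Rintegral => w _; rewrite /f row_window addr0.
apply: cvg_trans (cvgXY 0 0 f bf); apply: near_eq_cvg.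
near=> x; congr (_ / _); apply: eq_Rintegral => w _; congr (clamp (_ / _) * _).
have [_ NZ _] := nN.
rewrite linearZ/= row_window addr0 NZ mulrC ger0_norm// invr_ge0.
by near: x; exact: nbhs_pinfty_ge.
Unshelve. all: by end_near. Qed.

Let bclampX c (a b : R) :
  bmeas (fun w => clamp ((nrm (X 0%Z w) / c - a) / (b - a))).
Proof.
split; last by exists 1 => w; exact: clamp_norm_le1.
apply: measurableT_comp; first exact: (continuous_measurable_fun clamp_continuous).
apply: measurable_funM => //; apply: measurable_funB => //.
by apply: measurable_funM => //; exact: (measurable_nrm nN).
Qed.

Let bclampY (a b : R) : bmeas (fun w => clamp ((nrm (Y 0%Z w) - a) / (b - a))).
Proof.
split; last by exists 1 => w; exact: clamp_norm_le1.
apply: measurableT_comp; first exact: (continuous_measurable_fun clamp_continuous).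
apply: measurable_funM => //; apply: measurable_funB => //.
exact: (measurable_nrm nN).
Qed.

(** The indicator of |X_0| > u x lies between the ramps of |X_0| / x over [u, b] and over [a, u],
    the latter restricted to |X_0| > x. The limit of the first ramp is at least b^-alpha, that of
    the second at most a^-alpha, and both bounds tend to u^-alpha as a and b approach u. *)
Let ratio_ge1 u : 1 <= u -> (p (u * x) / p x) @[x --> +oo] --> u `^ (- alpha).
Proof.
move=> u1; have u0 : 0 < u by rewrite (lt_le_trans ltr01).
apply/cvgrPdist_le => e e0.
have e2 : 0 < e / 2 by rewrite divr_gt0.
have /cvgrPdist_le/(_ _ e2)/nbhs_ballP[del /= del0 hdel] := powR_cvg (- alpha) u u0.
(* Small enough for [u - eta] to be positive and for both levels to lie within [del] of [u]. *)
pose eta := Num.min (del / 2) (u / 2).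
have eta0 : 0 < eta by rewrite lt_min !divr_gt0.
have etad : eta < del by rewrite /eta gt_min ltr_pdivrMr// mulr2n mulrDr mulr1 ltrDl del0.
have etau : eta < u by rewrite /eta gt_min orbC ltr_pdivrMr// mulr2n mulrDr mulr1 ltrDl u0.
pose a := u - eta; pose b := u + eta.
have a0 : 0 < a by rewrite subr_gt0.
have au : a < u by rewrite ltrBlDr ltrDl.
have ub : u < b by rewrite ltrDl.
have ha : `|u `^ (- alpha) - a `^ (- alpha)| <= e / 2.
  by apply: hdel; rewrite /ball/= opprB addrC subrK gtr0_norm.
have hb : `|u `^ (- alpha) - b `^ (- alpha)| <= e / 2.
  by apply: hdel; rewrite /ball/= opprD addrA subrr add0r normrN gtr0_norm.
have lo := cvg_clamp _ _ ub; have hi := cvg_clamp _ _ au.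
have Elo : b `^ (- alpha) <= \int[P']_w clamp ((nrm (Y 0%Z w) - u) / (b - u)).
  rewrite -qE; last by rewrite (le_trans u1)// ltW.
  apply: RI_le => // w; rewrite indYE; case: ltP => bY; last exact: clamp_ge0.
  by rewrite clamp1// ler_pdivlMr ?subr_gt0// mul1r lerD2r ltW.
have Ehi : \int[P']_w clamp ((nrm (Y 0%Z w) - a) / (u - a)) <= a `^ (- alpha).
  apply: le_trans (q_le _ a0); apply: RI_le => // w; rewrite indYE.
  case: ltP => Ya; first exact: clamp_le1.
  by rewrite clamp0// pmulr_lle0 ?invr_gt0 ?subr_gt0// subr_le0.
near=> x.
have x0 : 0 < x by near: x; exact: nbhs_pinfty_gt.
have px0 : 0 < p x by near: x; exact: p_gt0.
have lox : \int[P']_w clamp ((nrm (Y 0%Z w) - u) / (b - u)) - e / 2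
    <= p (u * x) / p x.
  apply: (@le_trans _ _ (\int[P]_w (clamp ((nrm (X 0%Z w) / x - u) / (b - u)) * ind x w) / p x)).
    near: x; have /cvgrPdist_le/(_ _ e2) := lo; apply: filterS => x.
    by rewrite ler_distl => /andP[_]; rewrite lerBlDr.
  rewrite ler_pM2r ?invr_gt0// pE; apply: RI_le => //; first exact: bmeasM.
  move=> w; rewrite !indE; case: ltP => xX; last by rewrite mulr0 ler0n.
  rewrite mulr1; case: ltP => uX; first exact: clamp_le1.
  by rewrite clamp0// pmulr_lle0 ?invr_gt0 ?subr_gt0// subr_le0 ler_pdivrMr.
have hix : p (u * x) / p x <=
    \int[P']_w clamp ((nrm (Y 0%Z w) - a) / (u - a)) + e / 2.
  apply: (@le_trans _ _ (\int[P]_w (clamp ((nrm (X 0%Z w) / x - a) / (u - a)) * ind x w) / p x)).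
    rewrite ler_pM2r ?invr_gt0// pE; apply: RI_le => //; first exact: bmeasM.
    move=> w; rewrite !indE; case: (ltP (u * x)) => uX; last first.
      by rewrite mulr_ge0// clamp_ge0.
    rewrite (_ : x < _) ?mulr1; last by rewrite (le_lt_trans _ uX)// ler_peMl// ltW.
    by rewrite clamp1// ler_pdivlMr ?subr_gt0// mul1r lerD2r ler_pdivlMr// ltW.
  near: x; have /cvgrPdist_le/(_ _ e2) := hi; apply: filterS => x.
  by rewrite distrC ler_distl => /andP[_].
move: ha hb; rewrite !ler_distl => /andP[? ?] /andP[? ?].
by apply/andP; split; lra.
Unshelve. all: by end_near. Qed.

Let cvg_scale u : 0 < u -> (u * x) @[x --> +oo] --> (+oo : set_system R).
Proof. by move=> u0; apply: gt0_cvgMry => //; exact: cvg_id. Qed.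

(** For u < 1, the case of u^-1 along u x gives the limit of p(x) / p(u x), which is then
    inverted. *)
Let ratio u : 0 < u -> (p (u * x) / p x) @[x --> +oo] --> u `^ (- alpha).
Proof.
move=> u0; have [u1|u1] := leP 1 u; first exact: ratio_ge1.
have v1 : 1 <= u^-1 by rewrite invf_ge1// ltW.
have := cvg_comp _ _ (cvg_scale _ u0) (ratio_ge1 _ v1).
move=> /(cvgV (lt0r_neq0 (powR_gt0 _ _))).
rewrite invr_gt0 => /(_ u0).
rewrite -powRN opprK -[in X in _ --> X]powR_inv1 ?ltW// -powRrM mulN1r.
apply: cvg_trans; apply: near_eq_cvg; apply: nearW => x /=.
by rewrite mulKf ?gt_eqF// invf_div.
Qed.

(** Since X / x = u X / (u x), the assumed convergence along u x, applied to f(u .), handles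
    conditioning on |X_0| > u x; the factor p(u x) / p(x) changes the normalization. *)
Lemma cvg_tail_scaled u s n (f : 'M[R]_(n.+1, d) -> R) : 0 < u -> bounded_cont f ->
  (\int[P]_w (f (x^-1 *: WX s n.+1 w) * ind (u * x) w) / p x) @[x --> +oo]
    --> u `^ (- alpha) * \int[P']_w f (u *: WY s n.+1 w).
Proof.
move=> u0 bf; rewrite mulrC.
have := cvg_comp _ _ (cvg_scale _ u0) (cvgXY s _ _ (bcont_scale u bf)).
move=> /cvgM/(_ (ratio _ u0)).
apply: cvg_trans; apply: near_eq_cvg; near=> x.
have pux : p (u * x) != 0.
  by near: x; exact: (cvg_scale _ u0 _ p_neq0).
rewrite /= mulrA divfK//; congr (_ / _); apply: eq_Rintegral => w _.
by rewrite scalerA invfM mulrA divff ?mul1r// gt_eqF.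
Unshelve. all: by end_near. Qed.

Let nrm_row s n (k : 'I_n) w : s + (k : nat)%:Z = 0 ->
  nrm (row k (WY s n w)) = nrm (Y 0%Z w).
Proof. by move=> sk; rewrite row_window sk. Qed.

Let bcont_clamp_row n (k : 'I_n) (a c : R) :
  bounded_cont (fun z : 'M[R]_(n, d) => clamp ((nrm (row k z) - a) / c)).
Proof.
exact/bcont_clamp/affine_continuous/row_norm_continuous.
Qed.

(** A ramp over [u, b] bounds the indicator from below, and the inequality passes to the limit in x.
    Letting b decrease to u then restores the indicator. *)
Let tail_scaling_le s n (k : 'I_n.+1) u (f : 'M[R]_(n.+1, d) -> R) (M : R) :
  s + (k : nat)%:Z = 0 -> 1 <= u -> continuous f -> (forall z, 0 <= f z <= M) ->
  \int[P']_w (f (WY s n.+1 w) * indY u w)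
    <= u `^ (- alpha) * \int[P']_w f (u *: WY s n.+1 w).
Proof.
move=> sk u1 cf fM; have u0 : 0 < u by rewrite (lt_le_trans ltr01).
have bf : bounded_cont f.
  by split => //; exists M => z; case/andP: (fM z) => f0 ?; rewrite ger0_norm.
have M0 : 0 <= M by case/andP: (fM 0) => /le_trans; apply.
set rhs := _ * _.
have lim b : u < b -> \int[P']_w (f (WY s n.+1 w) *
    clamp ((nrm (row k (WY s n.+1 w)) - u) / (b - u))) <= rhs.
  move=> ub; have bg := bcont_mul bf (bcont_clamp_row n.+1 k u (b - u)).
  have c1 := cvgXY s _ _ bg; have c2 := cvg_tail_scaled u s n f u0 bf.
  apply: (ler_cvg_to c1 c2); near=> x.
  have x0 : 0 < x by near: x; exact: nbhs_pinfty_gt.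
  have px0 : 0 < p x by near: x; exact: p_gt0.
  rewrite ler_pM2r ?invr_gt0//; apply: RI_le.
  - by apply: bmeasM => //; exact: (bWX _ _ _ _ bg).
  - by apply: bmeasM => //; exact: bWX.
  move=> w; rewrite !indE; have [f0 _] := andP (fM (x^-1 *: WX s n.+1 w)).
  case: ltP => xX; last by rewrite mulr0 mulr_ge0.
  rewrite mulr1; apply: ler_wpM2l => //.
  rewrite linearZ/= row_window sk; have [_ NZ _] := nN.
  rewrite NZ ger0_norm ?invr_ge0 ?(ltW x0)//.
  case: (ltP (u * x)) => uX; first exact: clamp_le1.
  rewrite clamp0// pmulr_lle0 ?invr_gt0 ?subr_gt0// subr_le0.
  by rewrite mulrC ler_pdivrMr.
(* Ramp and indicator differ only on u < |Y_0| <= b, so the error is at most [M] times the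
   probability of that event. *)
have bound b : u < b -> \int[P']_w (f (WY s n.+1 w) * indY u w)
    <= rhs + M * (u `^ (- alpha) - b `^ (- alpha)).
  move=> ub; rewrite -(qE _ u1) -(qE b) ?(le_trans u1) ?(ltW ub)//.
  rewrite -RI_B// -RI_Z; last exact: bmeasB.
  apply: (le_trans _ (lerD (lim b ub) (lexx _))).
  have bg := bWY s _ _ (bcont_mul bf (bcont_clamp_row n.+1 k u (b - u))).
  have bi : bmeas (fun w => M * (indY u w - indY b w)) by apply: bmeasZ; exact: bmeasB.
  rewrite -RI_D//; apply: RI_le.
  - by apply: bmeasM => //; exact: bWY.
  - exact: bmeasD.
  move=> w; rewrite nrm_row// !indYE; have [f0 fM'] := andP (fM (WY s n.+1 w)).
  case: (ltP u) => uY; last first.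
    by rewrite mulr0 (ltNge b) (le_trans uY (ltW ub))/= subrr mulr0 addr0 mulr_ge0 ?clamp_ge0.
  case: (ltP b) => bY.
    rewrite subrr mulr0 addr0 clamp1//.
    by rewrite ler_pdivlMr ?subr_gt0// mul1r lerD2r ltW.
  by rewrite subr0 !mulr1 (le_trans fM')// lerDr mulr_ge0 ?clamp_ge0.
apply/ler_addgt0Pr => e e0.
(* [M + 1] avoids a division by zero when [M = 0]. *)
have eM : 0 < e / (M + 1) by rewrite divr_gt0// ltr_wpDl.
have /cvgrPdist_le/(_ _ eM)/nbhs_ballP[del /= del0 hdel] := powR_cvg (- alpha) u u0.
have ub : u < u + del / 2 by rewrite ltrDl divr_gt0.
apply: (le_trans (bound _ ub)); rewrite lerD2l.
apply: (@le_trans _ _ (M * (e / (M + 1)))).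
  rewrite ler_wpM2l//; apply: le_trans (ler_norm _) _; apply: hdel.
  rewrite /ball/= opprD addrA subrr add0r normrN gtr0_norm ?divr_gt0//.
  by rewrite ltr_pdivrMr// mulr2n mulrDr mulr1 ltrDl.
by rewrite mulrCA ler_piMr ?(ltW e0)// ler_pdivrMr ?ltr_wpDl// mul1r lerDl.
Unshelve. all: by end_near. Qed.

(* The one-sided bound for [M + f] and [M - f] gives equality, because the total masses agree. *)
Lemma tail_scaling s n (k : 'I_n.+1) u (f : 'M[R]_(n.+1, d) -> R) :
  s + (k : nat)%:Z = 0 -> 1 <= u -> bounded_cont f ->
  \int[P']_w (f (WY s n.+1 w) * indY u w)
    = u `^ (- alpha) * \int[P']_w f (u *: WY s n.+1 w).
Proof.
move=> sk u1 bf; have [cf [M fM]] := bf.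
have fb z : (0 <= M + f z <= M + M) /\ (0 <= M - f z <= M + M).
  by move: (fM z); rewrite ler_norml => /andP[? ?]; split; apply/andP; split; lra.
have c1 : continuous (fun z => M + f z).
  by move=> z; exact: (cvgD (cvg_cst M) (cf z)).
have c2 : continuous (fun z => M - f z).
  by move=> z; exact: (cvgB (cvg_cst M) (cf z)).
have bfi : bmeas (fun w => f (WY s n.+1 w) * indY u w) by apply: bmeasM => //; exact: bWY.
have E1 : \int[P']_w ((M + f (WY s n.+1 w)) * indY u w) =
    M * \int[P']_w indY u w + \int[P']_w (f (WY s n.+1 w) * indY u w).
  rewrite -RI_Z// -RI_D//; last exact: bmeasZ.
  by apply: eq_Rintegral => w _; rewrite mulrDl.
have E2 : \int[P']_w ((M - f (WY s n.+1 w)) * indY u w) =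
    M * \int[P']_w indY u w - \int[P']_w (f (WY s n.+1 w) * indY u w).
  rewrite -RI_Z// -RI_B//; last exact: bmeasZ.
  by apply: eq_Rintegral => w _; rewrite mulrBl.
have := tail_scaling_le s n k u _ _ sk u1 c1 (fun z => (fb z).1).
have := tail_scaling_le s n k u _ _ sk u1 c2 (fun z => (fb z).2).
rewrite E1 E2 RI_B; [|exact: bmeas_cst|exact: bWYZ].
rewrite RI_D; [|exact: bmeas_cst|exact: bWYZ].
rewrite qE// RI_cst mulrBr mulrDr (mulrC M) !lerD2l lerN2 => h1 h2.
by apply/eqP; rewrite eq_le h1 h2.
Qed.

Let nrm_rowZ s n (k : 'I_n) c w : s + (k : nat)%:Z = 0 ->
  nrm (row k (c *: WY s n w)) = `|c| * nrm (Y 0%Z w).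
Proof.
by move=> sk; rewrite (row_normZ nN) nrm_row.
Qed.

(** * The spectral process and its independence of |Y_0| *)

Let Theta (t : int) (w : T') : 'rV[R]_d := (nrm (Y 0%Z w))^-1 *: Y t w.
Let WT s n w : 'M[R]_(n, d) := window (fun t => Theta t w) s n.

Let WTE s n w : WT s n w = (nrm (Y 0%Z w))^-1 *: WY s n w.
Proof. by rewrite /WT window_scale. Qed.

Let P'_gt1 : P' [set w | 1 < nrm (Y 0%Z w)] = 1%E.
Proof. by rewrite Ytail// powR1. Qed.

Lemma rand_mx_spectral t : rand_mx (Theta t).
Proof. exact: (rand_mx_normalize nN _ _ (rY 0) (rY t)). Qed.

Let rWT s n : rand_mx (WT s n).
Proof. exact: rand_mx_window rand_mx_spectral. Qed.

(** The maximum with 1 keeps the denominator away from 0, so the normalization is continuous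
    everywhere; it is the true one wherever row [k] has norm at least 1. *)
Let cont_normalize n (k : 'I_n) (f : 'M[R]_(n, d) -> R) : bounded_cont f ->
  bounded_cont (fun z : 'M[R]_(n, d) => f ((Num.max (nrm (row k z)) 1)^-1 *: z)).
Proof.
move=> bf; apply: (bcont_comp bf) => z.
have cm : {for z, continuous (fun z : 'M[R]_(n, d) => Num.max (nrm (row k z)) 1)}.
  by apply: continuous_max; [exact: row_norm_continuous|exact: cst_continuous].
apply: (@cvgZ _ _ _ (nbhs z) _ (fun z : 'M[R]_(n, d) => (Num.max (nrm (row k z)) 1)^-1) id).
  apply: cvgV => //.
  by rewrite gt_eqF// lt_max ltr01 orbT.
exact: cvg_id.
Qed.

(** Let F be f composed with the normalization by row [k], which is time 0. Almost surely |Y_0| > 1,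
    hence F(Y) = F(u Y) = f(Theta), and the scaling identity for F reads E[f(Theta); |Y_0| > u] =
    u^-alpha E f(Theta). *)
Lemma spectral_indep_tail s n (k : 'I_n.+1) u (B : set 'M[R]_(n.+1, d)) :
  s + (k : nat)%:Z = 0 -> 1 <= u -> mxBorel B ->
  P' (WT s n.+1 @^-1` B `&` [set w | u < nrm (Y 0%Z w)]) =
  ((u `^ (- alpha))%:E * P' (WT s n.+1 @^-1` B))%E.
Proof.
move=> sk u1; have u0 : 0 < u by rewrite (lt_le_trans ltr01).
apply: mxBorel_proportional => // [|f cf f01]; first exact: powR_ge0.
have bf : bounded_cont f.
  by split=> //; exists 1 => z; case/andP: (f01 z) => f0 ?; rewrite ger0_norm.
pose F (z : 'M[R]_(n.+1, d)) := f ((Num.max (nrm (row k z)) 1)^-1 *: z).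
have bF : bounded_cont F by exact: cont_normalize.
have bT : bmeas (fun w => f (WT s n.+1 w)) by exact: bmeas_bcont.
have E1 : \int[P']_w (F (WY s n.+1 w) * indY u w) =
    \int[P']_w (f (WT s n.+1 w) * indY u w).
  apply: (RI_full P' _ _ _ (mY 1) P'_gt1).
  - by apply: bmeasM => //; exact: bWY.
  - exact: bmeasM.
  - by move=> w /= Y1; rewrite /F nrm_row// max_l ?(ltW Y1)// WTE.
have E2 : \int[P']_w F (u *: WY s n.+1 w) = \int[P']_w f (WT s n.+1 w).
  apply: (RI_full P' _ _ _ (mY 1) P'_gt1) => //; first exact: bWYZ.
  move=> w /= Y1; rewrite /F nrm_rowZ//.
  have uY : 1 <= u * nrm (Y 0 w) by rewrite -[1]mulr1 ler_pM// ltW.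
  by rewrite gtr0_norm// max_l// WTE scalerA invfM mulrAC mulVf ?mul1r// gt_eqF.
by have := tail_scaling s n k u F sk u1 bF; rewrite E1 E2.
Qed.

Lemma gen_sigma_spectral_measurable E : gen_sigma Theta E -> measurable E.
Proof.
apply: smallest_sub; first exact: sigma_algebra_measurable.
by move=> _ [t _] [B mB <-]; exact: rand_mx_spectral.
Qed.

(** Events that depend on Theta over [-m, m]. These windows are nested, so any two cylinders can be
    written over a common window, which yields closure under intersection. *)
Let cylinder (m : nat) (B : set 'M[R]_(m.*2.+1, d)) : set T' :=
  WT (- m%:Z) m.*2.+1 @^-1` B.

Let cylinders := [set E | exists m B, mxBorel B /\ E = cylinder m B].

Let cylinder_widen m m' (B : set 'M[R]_(m.*2.+1, d)) : (m <= m')%N -> mxBorel B ->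
  exists2 B' : set 'M[R]_(m'.*2.+1, d), mxBorel B' & cylinder m B = cylinder m' B'.
Proof.
move=> mm' mB.
pose phi : 'M[R]_(m'.*2.+1, d) -> 'M[R]_(m.*2.+1, d) :=
  rowsub (fun i : 'I_m.*2.+1 => inord (`|(- m%:Z) - (- m'%:Z)|%N + i)).
exists (phi @^-1` B); first exact: (mxBorel_preimage (rowsub_continuous _ _ _ _)).
apply/funext => w; rewrite /cylinder /preimage/=; congr (B _).
by apply: window_sub; lia.
Qed.

Let cylinders_setI : setI_closed cylinders.
Proof.
move=> _ _ [m [B [mB ->]]] [m' [B' [mB' ->]]].
have [C mC ->] := cylinder_widen _ _ _ (leq_maxl m m') mB.
have [C' mC' ->] := cylinder_widen _ _ _ (leq_maxr m m') mB'.
exists (maxn m m'), (C `&` C'); split=> //.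
exact: (@measurableI _ (@mxB R _ d)).
Qed.

Let gen_sigma_cylinders : gen_sigma Theta `<=` <<s cylinders >>.
Proof.
apply: smallest_sub; first exact: smallest_sigma_algebra.
move=> _ [t _] [B mB <-]; apply: sub_sigma_algebra.
(* The window [-|t|, |t|] contains time t, at row t + |t|. *)
exists `|t|%N.
pose k : 'I_(`|t|%N.*2.+1) := inord (absz (t + (`|t|%N)%:Z)).
exists (row k @^-1` B); split.
  exact: (mxBorel_preimage (row_continuous _ _ _)).
apply/funext => w; rewrite /cylinder /preimage/=; congr (B _).
by rewrite row_window inordK; [congr Theta; lia|lia].
Qed.

(** Both sides are finite measures in [E] that agree on cylinders, a generating class closed under
    intersection. *)
Lemma gen_sigma_indep_tail u E : 1 <= u -> gen_sigma Theta E ->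
  P' (E `&` [set w | u < nrm (Y 0%Z w)]) = ((u `^ (- alpha))%:E * P' E)%E.
Proof.
move=> u1 /gen_sigma_cylinders.
pose m1 : {measure set T' -> \bar R} := mrestr P' (mY u).
pose m2 : {measure set T' -> \bar R} := mscale (NngNum (powR_ge0 u (- alpha))) P'.
apply: (@g_sigma_algebra_measure_unique _ _ _ cylinders _ (fun=> setT) _ _ m1 m2) => //.
- by move=> _ [m [B [mB ->]]]; exact: rWT.
- move=> _; exists 0%N, setT; split; last by rewrite /cylinder preimage_setT.
  exact: (@measurableT _ (@mxB R _ d)).
- by apply/seteqP; split=> // w _; exists 0%N.
- move=> _ [m [B [mB ->]]]; rewrite /m1 /m2 /= /mrestr /mscale/=.
  (* Time 0 is row [m] of the window starting at -m. *)
  apply: (@spectral_indep_tail _ _ (inord m)) => //.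
  by rewrite inordK; lia.
- move=> k; rewrite /m1/= /mrestr.
  exact: le_lt_trans (probability_le1 P' (measurableI _ _ measurableT (mY u))) (ltry _).
Qed.

(** Both sides are finite measures in [A], so rays ]u, +oo[ suffice. For u >= 1 this is the
    assumption on [E]; for u < 1 the ray has full probability because |Y_0| > 1 almost surely. *)
Lemma tail_indep (A : set R) (E : set T') : measurable A -> measurable E ->
  (forall u, 1 <= u -> P' (E `&` [set w | u < nrm (Y 0%Z w)]) =
    ((u `^ (- alpha))%:E * P' E)%E) ->
  P' ([set w | nrm (Y 0%Z w) \in A] `&` E)
  = (P' [set w | nrm (Y 0%Z w) \in A] * P' E)%E.
Proof.
move=> mA mE Etail.
pose N0 w := nrm (Y 0%Z w).
have mN : measurable_fun setT N0 by exact: (measurable_nrm nN _ (rY 0)).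
pose Nm : {mfun T' >-> R} := mfun_Sub (mem_set mN).
pose m1f : {measure set R -> \bar R} := pushforward (mrestr P' mE) Nm.
pose m1 := m1f mN.
have c0 : 0 <= fine (P' E) by exact: fine_ge0.
pose m2 : {measure set R -> \bar R} := mscale (NngNum c0) (distribution P' Nm).
have -> : [set w | nrm (Y 0%Z w) \in A] = N0 @^-1` A.
  by apply/seteqP; split=> w /=; rewrite inE.
rewrite muleC -[P' E]fineK ?fin_num_measure//.
suff : m1 A = m2 A by [].
apply: (@measure_unique _ R _ (@RGenOInfty.G R)
  (fun k => `](- k%:R), +oo[%classic) _ _ _ _ m1 m2 _ _ A mA) => //.
- exact: RGenOInfty.measurableE.
- move=> _ _ [x ->] [y ->]; exists (Num.max x y).
  by apply/seteqP; split=> z /=; rewrite !in_itv/= ?andbT gt_max;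
    [case=> -> ->|case/andP].
- by move=> k; exists (- k%:R).
- apply/seteqP; split=> // x _; exists (Num.bound `|x|) => //=.
  by rewrite in_itv/= andbT ltrNl (le_lt_trans (ler_norm _))// normrN archi_boundP.
- move=> _ [u ->]; rewrite -[m1 _]/(P' (N0 @^-1` `]u, +oo[ `&` E)).
  rewrite -[m2 _]/((fine (P' E))%:E * P' (N0 @^-1` `]u, +oo[))%E.
  rewrite fineK ?fin_num_measure//.
  have -> : N0 @^-1` `]u, +oo[ = [set w | u < N0 w].
    by apply/seteqP; split=> w /=; rewrite in_itv/= andbT.
  have [u1|u1] := leP 1 u.
    by rewrite setIC Etail// Ytail// muleC.
  have full : P' [set w | u < N0 w] = 1%E.
    apply/eqP; rewrite eq_le probability_le1//= -P'_gt1.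
    by apply: le_measure; rewrite ?inE// => w /=; exact: lt_trans.
  rewrite full mule1; apply/eqP; rewrite eq_le; apply/andP; split.
    by apply: le_measure; rewrite ?inE//; exact: measurableI.
  (* At u = 1 the assumption says that intersecting [E] with |Y_0| > 1 loses no mass; the larger
     event |Y_0| > u loses none either. *)
  have := Etail _ (lexx 1); rewrite powR1 mul1e => <-.
  apply: le_measure; rewrite ?inE//; [exact: measurableI|exact: measurableI|].
  by move=> w [Ew /= w1]; split=> //; exact: lt_trans w1.
- move=> k; rewrite -[m1 _]/(P' (_ `&` E)).
  apply: le_lt_trans (probability_le1 P' _) (ltry _); apply: measurableI => //.
  by rewrite -[X in measurable X]setTI; exact: (mN measurableT _ (measurable_itv _)).
Qed.

Lemma spectral_indep (A : set R) (E : set T') : measurable A -> gen_sigma Theta E ->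
  P' ([set w | nrm (Y 0%Z w) \in A] `&` E)
  = (P' [set w | nrm (Y 0%Z w) \in A] * P' E)%E.
Proof.
move=> mA gE; apply: tail_indep => //; first exact: gen_sigma_spectral_measurable.
by move=> u u1; exact: gen_sigma_indep_tail.
Qed.

(** * Time change *)

(** The test function in the norm: 0 up to 1 and equal to 1 from 2 on. Its expectation [H] is
    positive and is cancelled at the end. *)
Let h (r : R) : R := clamp (r - 1).
Let H := \int[P']_w h (nrm (Y 0%Z w)).

Let h_ge0 r : 0 <= h r. Proof. exact: clamp_ge0. Qed.

Let h0 r : r <= 1 -> h r = 0.
Proof. by move=> r1; rewrite /h clamp0// subr_le0. Qed.

Let h_continuous : continuous h.
Proof.
move=> x; apply: (@continuous_comp _ _ _ (fun r : R => r - 1) clamp).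
  by apply: continuousB; [exact: cvg_id|exact: cst_continuous].
exact: clamp_continuous.
Qed.

Let mh : measurable_fun setT h := continuous_measurable_fun h_continuous.

Let bcont_h n (k : 'I_n) (c : R) :
  bounded_cont (fun z : 'M[R]_(n, d) => h (c * nrm (row k z))).
Proof.
exact/bcont_clamp/scale_shift_continuous/row_norm_continuous.
Qed.

Let bh (c : R) : bmeas (fun w => h (c * nrm (Y 0%Z w))).
Proof.
split; last by exists 1 => w; exact: clamp_norm_le1.
apply: (measurableT_comp mh); apply: measurable_funM => //.
exact: (measurable_nrm nN _ (rY 0)).
Qed.

Let bh1 : bmeas (fun w => h (nrm (Y 0%Z w))).
Proof. by have := bh 1; under eq_fun do rewrite mul1r. Qed.

Let H_gt0 : 0 < H.
Proof.
apply: (@lt_le_trans _ _ (2 `^ (- alpha))); first exact: powR_gt0.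
rewrite -qE ?ler1n//; apply: RI_le => // w; rewrite indYE; case: ltP => // Y2.
by rewrite /h clamp1// lerBrDr; exact: ltW.
Qed.

(** This is the scaling identity at u = c^-1 for the function h(c |y_0|), which vanishes unless
    |y_0| > c^-1, so that the indicator in that identity may be dropped. *)
Let H_scale c : 0 < c -> c <= 1 ->
  \int[P']_w h (c * nrm (Y 0%Z w)) = c `^ alpha * H.
Proof.
move=> c0 c1; have u1 : 1 <= c^-1 by rewrite invf_ge1.
have u0 : 0 < c^-1 by rewrite invr_gt0.
have := tail_scaling 0 0 ord0 c^-1 _ (addr0 0) u1 (bcont_h 1 ord0 c).
rewrite -powR_inv1 ?(ltW c0)// -powRrM mulN1r opprK.
have -> : \int[P']_w (h (c * nrm (row ord0 (WY 0 1 w))) * indY (c `^ (-1)) w) =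
    \int[P']_w h (c * nrm (Y 0%Z w)).
  apply: eq_Rintegral => w _; rewrite nrm_row// indYE powR_inv1 ?(ltW c0)//.
  case: ltP => cY; first by rewrite mulr1.
  by rewrite mulr0 h0// -ler_pdivlMl// mulr1.
move=> ->; congr (_ * _); apply: eq_Rintegral => w _.
by rewrite nrm_rowZ// powR_inv1 ?(ltW c0)// gtr0_norm// mulVKf// gt_eqF.
Qed.

Let big m w : 'M[R]_(m.*2.+1, d) := WT (- m%:Z) m.*2.+1 w.

Lemma spectral_fubini m (Phi : @mxB R m.*2.+1 d * R -> \bar R) :
  measurable_fun setT Phi -> (forall z, 0 <= Phi z)%E ->
  (\int[P']_w Phi (big m w, nrm (Y 0%Z w)) =
   \int[P']_w \int[P']_w' Phi (big m w, nrm (Y 0%Z w')))%E.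
Proof.
move=> mPhi Phi0.
apply: (indep_integral P' (big m : T' -> @mxB R m.*2.+1 d) (fun w => nrm (Y 0%Z w)) Phi) => //.
- exact/rand_mxP/rWT.
- exact: (measurable_nrm nN _ (rY 0)).
move=> B A mB mA; have mE : measurable (big m @^-1` B) by exact: rWT.
have -> : (fun w => nrm (Y 0%Z w)) @^-1` A = [set w | nrm (Y 0%Z w) \in A].
  by apply/seteqP; split=> w /=; rewrite inE.
rewrite setIC muleC; apply: tail_indep => // u u1.
apply: (spectral_indep_tail _ _ (inord m)) => //.
by rewrite inordK; lia.
Qed.

(** Stationarity equates the laws of the two windows, and each side is an integral of [g] against
    such a law. *)
Lemma stationary_integral n (s s' : int) (g : 'M[R]_(n, d) -> R) : bounded_cont g ->
  (forall z, 0 <= g z) ->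
  \int[P]_w g (WX s n w) = \int[P]_w g (WX s' n w).
Proof.
move=> [cg _] g0; congr fine.
have mW t : measurable_fun setT (WX t n : T -> @mxB R n d).
  exact/rand_mxP/rand_mx_window.
pose Wm t : {mfun T >-> @mxB R n d} := mfun_Sub (mem_set (mW t)).
have mg : measurable_fun setT (EFin \o g : @mxB R n d -> \bar R).
  by apply/measurable_EFinP; exact: (continuous_mxB_measurable _ _ _ cg).
have E t : (\int[P]_w (g (WX t n w))%:E = \int[distribution P (Wm t)]_z (g z)%:E)%E.
  rewrite (ge0_integral_pushforward (mW t) P measurableT mg) // => z _.
  by rewrite lee_fin.
rewrite !E; apply: eq_measure_integral => B mB _.
have := stat (s - s') s' n B mB; rewrite addrC subrK.
have WE t : [set w | window (fun t => X t w) t n \in B] = WX t n @^-1` B.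
  by apply/seteqP; split=> w /=; rewrite inE.
by rewrite !WE.
Qed.

Section time_change.
Context (i s : int) (n : nat).
Hypotheses (s_le0 : s <= 0) (sn_ge0 : 0 <= s + n%:Z).

(** Large enough for [-m, m] to contain i and both ranges [s, s + n] and [s - i, s - i + n]. As s <=
    0, row [k0] of a window starting at s is time 0. *)
Let m : nat := (`|i|%N + `|i|%N + `|s|%N + n)%N.
Let k0 : 'I_n.+1 := inord `|s|%N.
(* The row of time [i] in the window from [- m], of time [0] in the one from [- m - i]. *)
Let ki : 'I_m.*2.+1 := inord (absz (i + m%:Z)).
(** From a window starting at -m these rows are the times s, ..., s + n; from one starting at -m - i
    they are the times s - i, ..., s - i + n. *)
Let sub (z : 'M[R]_(m.*2.+1, d)) : 'M[R]_(n.+1, d) :=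
  rowsub (fun j : 'I_n.+1 => inord (absz (s + m%:Z) + j)) z.

Let sub_continuous : continuous sub. Proof. exact: rowsub_continuous. Qed.

Let subZ c z : sub (c *: z) = c *: sub z.
Proof. by apply/matrixP => a b; rewrite !mxE. Qed.

Let sub_window {T0 : Type} (Z : int -> T0 -> 'rV[R]_d) w :
  sub (window (fun t => Z t w) (- m%:Z) m.*2.+1) = window (fun t => Z t w) s n.+1.
Proof.
rewrite (@window_sub _ _ _ s (- m%:Z) _ m.*2); [|lia|lia].
by rewrite /sub opprK.
Qed.

Let sub_window_shift {T0 : Type} (Z : int -> T0 -> 'rV[R]_d) w :
  sub (window (fun t => Z t w) (- m%:Z - i) m.*2.+1) =
  window (fun t => Z t w) (s - i) n.+1.
Proof.
rewrite (@window_sub _ _ _ (s - i) (- m%:Z - i) _ m.*2); [|lia|lia].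
have -> : s - i - (- m%:Z - i) = s + m%:Z by lia.
by [].
Qed.

Let ki_val : (ki : nat) = absz (i + m%:Z).
Proof. by rewrite inordK; lia. Qed.

Let k0_val : (k0 : nat) = `|s|%N.
Proof. by rewrite inordK; lia. Qed.

Let row_ki (Z : int -> 'rV[R]_d) : row ki (window Z (- m%:Z) m.*2.+1) = Z i.
Proof. by rewrite row_window ki_val; congr Z; lia. Qed.

Let ki_shift : - m%:Z - i + (ki : nat)%:Z = 0.
Proof. by rewrite ki_val; lia. Qed.

Let row_k0 (Z : int -> 'rV[R]_d) : row k0 (window Z s n.+1) = Z 0.
Proof. by rewrite row_window k0_val; congr Z; lia. Qed.

(** * Time change for nonnegative functions vanishing near y_0 = 0 *)

Section vanishing_near_zero.
Context (f : 'M[R]_(n.+1, d) -> R) (eps : R).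
Hypotheses (bf : bounded_cont f) (f_ge0 : forall y, 0 <= f y)
  (eps_gt0 : 0 < eps) (eps_le1 : eps <= 1)
  (f_eps : forall y, nrm (row k0 y) <= eps -> f y = 0).

(** This is f(y / |y_i|) h(|y_i|): the maximum with 1 gives continuity and changes no value, since h
    vanishes where |y_i| <= 1. *)
Let G (z : 'M[R]_(m.*2.+1, d)) : R :=
  f (sub ((Num.max (nrm (row ki z)) 1)^-1 *: z)) * h (1 * nrm (row ki z)).

Let bG : bounded_cont G.
Proof.
apply: (bcont_mul _ (bcont_h _ ki 1)).
by apply: (cont_normalize _ ki (f \o sub)); exact: bcont_comp bf sub_continuous.
Qed.

Let G_ge0 z : 0 <= G z. Proof. by rewrite mulr_ge0. Qed.

(** Both sides are limits of E[G(X / x)] / p(x), over two windows with the same law. *)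
Let G_shift :
  \int[P']_w G (WY (- m%:Z - i) m.*2.+1 w) =
  eps `^ (- alpha) * \int[P']_w G (eps *: WY (- m%:Z) m.*2.+1 w).
Proof.
have c1 : (\int[P]_w (G (x^-1 *: WX (- m%:Z - i) m.*2.+1 w) * ind x w) / p x)
    @[x --> +oo] --> \int[P']_w G (WY (- m%:Z - i) m.*2.+1 w) by exact: XY.
have c2 := cvg_tail_scaled eps (- m%:Z) _ _ eps_gt0 bG.
apply: (cvg_unique (@Rhausdorff R) c1); apply: cvg_trans c2; apply: near_eq_cvg; near=> x.
have x0 : 0 < x by near: x; exact: nbhs_pinfty_gt.
congr (_ / _).
(* Here row [ki] is X_0, so h makes G vanish unless |X_0| > x. *)
have W1 w : G (x^-1 *: WX (- m%:Z - i) m.*2.+1 w) * ind x w =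
    G (x^-1 *: WX (- m%:Z - i) m.*2.+1 w).
  rewrite indE; case: ltP => xX; first by rewrite mulr1.
  rewrite mulr0 /G h0 ?mulr0// mul1r (row_normZ nN) /WX row_window ki_shift.
  by rewrite gtr0_norm ?invr_gt0// mulrC ler_pdivrMr// mul1r.
(* Here row [k0] of the selected rows is X_0. Dividing by a maximum that is at least 1 only shrinks
   it, so |X_0| <= eps x makes f vanish. *)
have W2 w : G (x^-1 *: WX (- m%:Z) m.*2.+1 w) * ind (eps * x) w =
    G (x^-1 *: WX (- m%:Z) m.*2.+1 w).
  rewrite indE; case: ltP => xX; first by rewrite mulr1.
  rewrite mulr0 /G f_eps ?mul0r// !subZ /WX sub_window !(row_normZ nN) row_k0.
  set M := Num.max _ _; have M1 : 1 <= M by rewrite le_max lexx orbT.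
  have M0 : 0 < M by rewrite (lt_le_trans ltr01).
  rewrite !gtr0_norm ?invr_gt0// ler_pdivrMl// ler_pdivrMl//.
  by apply: (le_trans xX); rewrite [leRHS]mulrCA mulrC ler_peMl// mulr_ge0// ltW.
transitivity (\int[P]_w G (x^-1 *: WX (- m%:Z) m.*2.+1 w)).
  by apply: eq_Rintegral => w _; rewrite W2.
transitivity (\int[P]_w G (x^-1 *: WX (- m%:Z - i) m.*2.+1 w)).
  apply: (stationary_integral _ _ _ (fun z => G (x^-1 *: z))) => //.
  exact: bcont_scale.
by apply: eq_Rintegral => w _; rewrite W1.
Unshelve. all: by end_near. Qed.

(** Normalization by |z_i| itself, for use on Theta, where |Theta_i| may be small; measurability is
    enough for Tonelli. Where |z_i| = 0 the argument of [f] is 0, and so is the value. *)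
Let J (z : 'M[R]_(m.*2.+1, d)) : R := f ((nrm (row ki z))^-1 *: sub z).

Let J_ge0 z : 0 <= J z. Proof. exact: f_ge0. Qed.

Let mJ : measurable_fun setT (J : @mxB R m.*2.+1 d -> R).
Proof.
have [cf _] := bf.
pose id' : @mxB R m.*2.+1 d -> 'M[R]_(m.*2.+1, d) := id.
have rid : rand_mx id' by move=> B mB.
have rki := rand_mx_comp rid (@row_continuous _ _ _ ki).
have rsub := rand_mx_comp rid sub_continuous.
exact: (rand_mx_comp_continuous (rand_mx_normalize nN _ _ rki rsub) cf).
Qed.

Let big_i w : row ki (big m w) = Theta i w.
Proof. exact: row_ki. Qed.

Let big_s w : sub (big m w) = WT s n.+1 w.
Proof. exact: sub_window. Qed.

(** Equality fails only at Y_0 = 0, where the convention [0^-1 = 0] gives Theta_0 = 0. *)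
Let nrm_Theta0 w : nrm (Theta 0 w) <= 1.
Proof.
have [_ NZ _] := nN; rewrite NZ ger0_norm ?invr_ge0 ?is_norm_ge0//.
have [->|Y0] := eqVneq (nrm (Y 0 w)) 0; first by rewrite mulr0.
by rewrite mulVf.
Qed.

(** A nonzero value forces eps < |Theta_0| / |Theta_i| <= 1 / |Theta_i|. Thus c = eps |Theta_i| lies
    in the range where [H_scale] applies. *)
Let J_neq0 w : J (big m w) != 0 ->
  0 < eps * nrm (Theta i w) /\ eps * nrm (Theta i w) <= 1.
Proof.
rewrite /J big_i big_s => J0.
have e0 : eps < nrm (row k0 ((nrm (Theta i w))^-1 *: WT s n.+1 w)).
  by rewrite ltNge; apply: contra_neqN J0; exact: f_eps.
move: e0; rewrite (row_normZ nN) row_k0 ger0_norm ?invr_ge0 ?is_norm_ge0// => e0.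
have c0 : 0 < nrm (Theta i w).
  rewrite lt_neqAle is_norm_ge0// andbT; apply: contraTneq e0 => <-.
  by rewrite invr0 mul0r -leNgt ltW.
split; first by rewrite mulr_gt0.
rewrite -ler_pdivlMr// div1r; apply: (le_trans (ltW e0)).
by rewrite ler_piMr ?invr_ge0 ?(ltW c0).
Qed.

(** Almost surely Y = |Y_0| Theta, and G(eps Y) becomes J(Theta) h(eps |Theta_i| |Y_0|).
    Independence allows |Y_0| to be integrated out first, by [H_scale] with c = eps |Theta_i|. *)
Let G_unshifted :
  (\int[P']_w G (eps *: WY (- m%:Z) m.*2.+1 w))%:E =
  ((eps `^ alpha * H)%:E *
   \int[P']_w (J (big m w) * nrm (Theta i w) `^ alpha)%:E)%E.
Proof.
pose Phi (zr : @mxB R m.*2.+1 d * R) : \bar R :=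
  (J zr.1 * h (eps * nrm (row ki zr.1) * zr.2))%:E.
have mN : measurable_fun setT (fun z : @mxB R m.*2.+1 d => nrm (row ki z)).
  by apply: continuous_mxB_measurable; exact: row_norm_continuous.
have mPhi : measurable_fun setT Phi.
  apply/measurable_EFinP; apply: measurable_funM.
    exact: (measurableT_comp mJ measurable_fst).
  apply: (measurableT_comp mh); apply: measurable_funM => //.
  by apply: measurable_funM => //; exact: (measurableT_comp mN measurable_fst).
have Phi0 z : (0 <= Phi z)%E by rewrite lee_fin mulr_ge0.
transitivity (\int[P']_w Phi (big m w, nrm (Y 0%Z w)))%E.
  rewrite bmeas_EFin; last exact: bWYZ.
  apply: ae_eq_integral => //.
  - by apply/measurable_EFinP; case: (bWYZ (- m%:Z) _ G eps bG).
  - apply: (measurableT_comp mPhi); apply: measurable_fun_pair.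
      exact/rand_mxP/rWT.
    exact: (measurable_nrm nN _ (rY 0)).
  exists (~` [set w | 1 < nrm (Y 0%Z w)]); split; first exact: measurableC.
    by have := probability_setC P' (mY 1); rewrite P'_gt1 subee.
  move=> w /= ne Y1; apply: ne => _; congr EFin.
  have Y0 : 0 < nrm (Y 0 w) by rewrite (lt_trans ltr01).
  rewrite /G /J (row_normZ nN) mul1r /WY row_ki (gtr0_norm eps_gt0).
  rewrite big_i big_s; have [_ NZ _] := nN.
  have TY : nrm (Theta i w) = (nrm (Y 0 w))^-1 * nrm (Y i w).
    by rewrite NZ gtr0_norm ?invr_gt0.
  have TYh : eps * nrm (Theta i w) * nrm (Y 0 w) = eps * nrm (Y i w).
    by rewrite TY -!mulrA (mulrC (nrm (Y i w))) mulKf// gt_eqF.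
  (* If eps |Y_i| <= 1, both sides vanish through h. Otherwise the maximum in [G] is eps |Y_i|, and
     eps cancels in the normalization. *)
  rewrite TYh; have [e1|e1] := leP (eps * nrm (Y i w)) 1; first by rewrite h0// !mulr0.
  congr (f _ * _); rewrite !subZ sub_window WTE !scalerA; congr (_ *: _).
  have Yi : nrm (Y i w) != 0.
    by apply: contraTneq e1 => ->; rewrite mulr0 -leNgt ler01.
  by rewrite TY; field; rewrite Yi !gt_eqF.
rewrite spectral_fubini//.
under eq_integral => w _.
  have -> : (\int[P']_w' Phi (big m w, nrm (Y 0%Z w')))%E =
      ((eps `^ alpha * H) * (J (big m w) * nrm (Theta i w) `^ alpha))%:E.
    rewrite /Phi /= -bmeas_EFin; last exact: bmeasZ.
    rewrite RI_Z// big_i.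
    have [J0|/J_neq0[c0 c1]] := eqVneq (J (big m w)) 0.
      by rewrite J0 !mul0r mulr0.
    rewrite H_scale// powRM ?is_norm_ge0 ?(ltW eps_gt0)//.
    by congr EFin; ring.
  over.
under eq_integral do rewrite EFinM.
rewrite ge0_integralZl//.
- apply/measurable_EFinP; apply: measurable_funM.
    apply: (measurableT_comp mJ); exact/rand_mxP/rWT.
  apply: (measurableT_comp (@measurable_powR R alpha)).
  exact: (measurable_nrm nN _ (rand_mx_spectral i)).
- by move=> w _; rewrite lee_fin mulr_ge0// powR_ge0.
- by rewrite lee_fin mulr_ge0 ?powR_ge0// ltW.
Qed.

(** In the window starting at -m - i, row [ki] is Y_0, so almost surely the integrand is f(Theta)
    h(|Y_0|), with Theta over the shifted range, and independence factors it. *)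
Let G_shifted :
  (\int[P']_w G (WY (- m%:Z - i) m.*2.+1 w))%:E =
  (H%:E * \int[P']_w (f (WT (s - i) n.+1 w))%:E)%E.
Proof.
have [cf _] := bf.
(* The independence formula uses the window [-m, m], from which the times s - i, ..., s - i + n are
   now selected. *)
pose sub' (z : 'M[R]_(m.*2.+1, d)) : 'M[R]_(n.+1, d) :=
  rowsub (fun j : 'I_n.+1 => inord (absz (s - i - - m%:Z)%R + j)) z.
have sub'E w : sub' (big m w) = WT (s - i) n.+1 w.
  by rewrite /WT (@window_sub _ _ _ (s - i) (- m%:Z) _ m.*2); [|lia|lia].
pose Phi (zr : @mxB R m.*2.+1 d * R) : \bar R := (f (sub' zr.1) * h zr.2)%:E.
have cfs : continuous (f \o sub').
  move=> z; exact: (continuous_comp (@rowsub_continuous _ _ _ _ _ z) (cf _)).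
have mPhi : measurable_fun setT Phi.
  apply/measurable_EFinP; apply: measurable_funM.
    exact: (measurableT_comp (continuous_mxB_measurable _ _ _ cfs) measurable_fst).
  exact: (measurableT_comp mh measurable_snd).
have Phi0 z : (0 <= Phi z)%E by rewrite lee_fin mulr_ge0.
have bf' : bmeas (fun w => f (WT (s - i) n.+1 w)) by exact: bmeas_bcont.
transitivity (\int[P']_w Phi (big m w, nrm (Y 0%Z w)))%E.
  rewrite -bmeas_EFin; last by rewrite /=; under eq_fun do rewrite sub'E; exact: bmeasM.
  congr EFin; apply: (RI_full P' _ _ _ (mY 1) P'_gt1); first exact: bWY.
    by rewrite /=; under eq_fun do rewrite sub'E; exact: bmeasM.
  move=> w /= Y1.
  rewrite /G nrm_row// max_l ?(ltW Y1)// mul1r sub'E WTE subZ.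
  by rewrite /WY sub_window_shift.
rewrite spectral_fubini//.
under eq_integral => w _.
  have -> : (\int[P']_w' Phi (big m w, nrm (Y 0%Z w')))%E =
      (H * f (WT (s - i) n.+1 w))%:E.
    by rewrite /Phi /= -bmeas_EFin ?RI_Z// ?sub'E 1?mulrC//; exact: bmeasZ.
  over.
under eq_integral do rewrite EFinM.
rewrite ge0_integralZl//.
- by apply/measurable_EFinP; case: bf'.
- by move=> w _; rewrite lee_fin.
- by rewrite lee_fin ltW.
Qed.

(** The two evaluations of G are equated by [G_shift]; the powers of eps cancel, and so does [H],
    which is positive. *)
Lemma time_change_vanishing :
  (\int[P']_w (f (WT (s - i) n.+1 w))%:E =
   \int[P']_w (f ((nrm (Theta i w))^-1 *: WT s n.+1 w) *
               nrm (Theta i w) `^ alpha)%:E)%E.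
Proof.
have HV : (H^-1 * H = 1)%R by rewrite mulVf// gt_eqF.
rewrite -[LHS]mul1e -HV EFinM -muleA -G_shifted G_shift EFinM G_unshifted.
rewrite !muleA -!EFinM.
have -> : H^-1 * eps `^ (- alpha) * (eps `^ alpha * H) = 1.
  by rewrite powRN; field; rewrite !gt_eqF// powR_gt0.
rewrite mul1e.
by apply: eq_integral => w _; rewrite /J big_i big_s.
Qed.

End vanishing_near_zero.

(** * Removal of the cutoff near y_0 = 0 *)

Let cutoff (k : nat) (y : 'M[R]_(n.+1, d)) : R :=
  clamp (k.+1%:R * nrm (row k0 y) - 1).

(** The cutoff increases with k and is eventually 1 wherever y_0 is nonzero, while f vanishes where
    y_0 = 0; monotone convergence applies. The weight [v] will be 1 on one side of the time change
    and |Theta_i|^alpha on the other. *)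
Let cvg_cutoff (f : 'M[R]_(n.+1, d) -> R) (Z : T' -> 'M[R]_(n.+1, d)) (v : T' -> R) :
  bounded_cont f -> (forall y, 0 <= f y) -> (forall y, row k0 y = 0 -> f y = 0) ->
  rand_mx Z -> measurable_fun setT v -> (forall w, 0 <= v w) ->
  (\int[P']_w (f (Z w) * cutoff k (Z w) * v w)%:E)%E @[k --> \oo] -->
  (\int[P']_w (f (Z w) * v w)%:E)%E.
Proof.
move=> [cf _] f0 frow rZ mv v0; have [_ _ N_eq0] := nN.
have -> : (\int[P']_w (f (Z w) * v w)%:E =
    \int[P']_w limn (fun k => (f (Z w) * cutoff k (Z w) * v w)%:E))%E.
  apply: eq_integral => w _; apply/esym/cvg_lim => //; apply: cvg_near_cst.
  have [Z0|Z0] := eqVneq (nrm (row k0 (Z w))) 0.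
    by apply: nearW => k; rewrite (frow _ (N_eq0 _ Z0)) !mul0r.
  have Zgt0 : 0 < nrm (row k0 (Z w)) by rewrite lt_neqAle eq_sym Z0 is_norm_ge0.
  near=> k; rewrite /cutoff clamp1 ?mulr1// lerBrDr -ler_pdivrMr//.
  apply: (@le_trans _ _ k%:R); last by rewrite ler_nat.
  by near: k; exact: nbhs_infty_ger.
apply: cvg_monotone_convergence => //.
- move=> k; apply/measurable_EFinP; apply: measurable_funM => //.
  apply: measurable_funM; first exact: (rand_mx_comp_continuous rZ cf).
  have cc : continuous (cutoff k).
    exact: (bcont_clamp (scale_shift_continuous _ _ (row_norm_continuous k0 nN))).1.
  exact: (rand_mx_comp_continuous rZ cc).
- by move=> k w _; rewrite lee_fin !mulr_ge0// clamp_ge0.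
- move=> w _ k l kl; rewrite lee_fin ler_wpM2r// ler_wpM2l//.
  apply: clamp_homo; rewrite lerD2r ler_wpM2r ?is_norm_ge0//.
  by rewrite ler_nat ltnS.
Unshelve. all: by end_near. Qed.

Let time_change_nonneg (f : 'M[R]_(n.+1, d) -> R) :
  bounded_cont f -> (forall y, 0 <= f y) -> (forall y, row k0 y = 0 -> f y = 0) ->
  (\int[P']_w (f (WT (s - i) n.+1 w))%:E =
   \int[P']_w (f ((nrm (Theta i w))^-1 *: WT s n.+1 w) *
               nrm (Theta i w) `^ alpha)%:E)%E.
Proof.
move=> bf f0 frow.
have rZ : rand_mx (fun w => (nrm (Theta i w))^-1 *: WT s n.+1 w).
  by apply: (rand_mx_normalize nN); [exact: rand_mx_spectral|exact: rWT].
have mv : measurable_fun setT (fun w => nrm (Theta i w) `^ alpha).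
  exact: (measurableT_comp (@measurable_powR R alpha)
    (measurable_nrm nN _ (rand_mx_spectral i))).
have := cvg_cutoff _ _ _ bf f0 frow rZ mv (fun w => powR_ge0 _ _).
have := cvg_cutoff _ _ (fun=> 1) bf f0 frow (rWT (s - i) n.+1)
  (measurable_cst _) (fun=> ler01).
have -> : (\int[P']_w (f (WT (s - i) n.+1 w) * 1)%:E =
    \int[P']_w (f (WT (s - i) n.+1 w))%:E)%E.
  by apply: eq_integral => w _; rewrite mulr1.
move=> c1 c2; apply: (cvg_unique _ c1) => //; apply: cvg_trans c2.
apply: near_eq_cvg; apply: nearW => k.
have bfk : bounded_cont (fun y => f y * cutoff k y).
  apply: (bcont_mul bf); apply: bcont_clamp.
  exact: (scale_shift_continuous _ _ (row_norm_continuous k0 nN)).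
(* The product with [cutoff k] vanishes for |y_0| <= 1 / (k + 1), which serves as eps. *)
rewrite -(time_change_vanishing (fun y => f y * cutoff k y) k.+1%:R^-1)//.
- by apply: eq_integral => w _; rewrite mulr1.
- by move=> y; rewrite mulr_ge0// clamp_ge0.
- by rewrite invf_le1// ler1n.
- move=> y yk; rewrite /cutoff clamp0 ?mulr0// subr_le0.
  by rewrite -ler_pdivlMl// mulr1.
Qed.

(** The integral is by definition the difference of those of the positive and negative parts. Taking
    these parts commutes with the nonnegative weight |Theta_i|^alpha, so the nonnegative case
    applies to each. *)
Lemma time_change (f : 'M[R]_(n.+1, d) -> R) :
  bounded_cont f -> (forall y, row k0 y = 0 -> f y = 0) ->
  Ex P' (fun w => f (WT (s - i) n.+1 w)) =
  Ex P' (fun w => if nrm (Theta i w) == 0 then 0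
                  else f ((nrm (Theta i w))^-1 *: WT s n.+1 w)
                       * nrm (Theta i w) `^ alpha).
Proof.
move=> [cf [M fM]] frow; rewrite /Ex.
(* The prescribed value 0 at Theta_i = 0 agrees with the weight, since 0^alpha = 0 for alpha > 0. *)
transitivity (\int[P']_w (f ((nrm (Theta i w))^-1 *: WT s n.+1 w) *
               nrm (Theta i w) `^ alpha)%:E)%E; last first.
  apply: eq_integral => w _; case: eqVneq => // ->.
  by rewrite powR0 ?mulr0// gt_eqF.
have part (g : 'M[R]_(n.+1, d) -> R) : continuous g -> (forall z, `|g z| <= M) ->
    (forall y, row k0 y = 0 -> g y = 0) ->
    (\int[P']_w (Num.max (g (WT (s - i) n.+1 w)) 0)%:E =
     \int[P']_w (Num.max (g ((nrm (Theta i w))^-1 *: WT s n.+1 w) *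
               nrm (Theta i w) `^ alpha) 0)%:E)%E.
  move=> cg gM grow.
  rewrite (time_change_nonneg (fun y => Num.max (g y) 0)).
  - by apply: eq_integral => w _; rewrite maxr_pMl ?powR_ge0// mul0r.
  - split.
      by move=> z; apply: continuous_max; [exact: cg|exact: cst_continuous].
    exists M => z; apply: le_trans (gM z).
    by rewrite ger0_norm ?le_max ?lexx ?orbT// ge_max ler_norm normr_ge0.
  - by move=> y; rewrite le_max lexx orbT.
  - by move=> y /grow ->; rewrite maxxx.
rewrite integralE [RHS]integralE; congr (_ - _)%E.
- under eq_integral do rewrite funeposE -EFin_max.
  by rewrite part//; apply: eq_integral => w _; rewrite funeposE -EFin_max.
- have cNf : continuous (fun z => - f z) by move=> z; exact: (cvgN (cf z)).
  under eq_integral do rewrite funenegE -EFinN -EFin_max.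
  rewrite (part (fun z => - f z) cNf).
  + by apply: eq_integral => w _; rewrite funenegE -EFinN -EFin_max mulNr.
  + by move=> z; rewrite normrN.
  + by move=> y /frow ->; rewrite oppr0.
Qed.

End time_change.
End tail_process.

Theorem theorem2p2 (R : realType) (d : nat) (alpha : R)
  (dT : measure_display) (T : measurableType dT) (P : probability T R)
  (X : int -> T -> 'rV[R]_d)
  (nrm : 'rV[R]_d -> R)
  (dT' : measure_display) (T' : measurableType dT') (P' : probability T' R)
  (Y : int -> T' -> 'rV[R]_d) :
  0 < alpha ->
  (forall t, rand_mx (X t)) ->
  strictly_stationary P X ->
  jointly_regvar P X alpha ->
  is_norm nrm ->
  (forall t, rand_mx (Y t)) ->
  (forall y : R, 1 <= y -> P' [set w | y < nrm (Y 0%Z w)] = (y `^ (- alpha))%:E) ->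
  (forall (s : int) (n : nat) (f : 'M[R]_(n.+1, d) -> R), bounded_cont f ->
     (fun x : R =>
        fine (Ex P (fun w => f (x^-1 *: window (fun t => X t w) s n.+1) *
                             \1_[set w' | x < nrm (X 0%Z w')] w))
        / fine (P [set w | x < nrm (X 0%Z w)]))
     @ +oo --> fine (Ex P' (fun w => f (window (fun t => Y t w) s n.+1)))) ->
  let Theta := fun (t : int) (w : T') => (nrm (Y 0%Z w))^-1 *: Y t w in
  (* (i) ||Y_0|| is independent of (Theta_t)_{t in Z} *)
  (forall (A : set R) (E : set T'), measurable A -> gen_sigma Theta E ->
     P' ([set w | nrm (Y 0%Z w) \in A] `&` E)
     = (P' [set w | nrm (Y 0%Z w) \in A] * P' E)%E)
  /\
  (* (ii) the time-change formula *)
  (forall (i s : int) (n : nat) (f : 'M[R]_(n.+1, d) -> R),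
     s <= 0 -> 0 <= s + n%:Z -> bounded_cont f ->
     (forall y : 'M[R]_(n.+1, d),
         row (inord `|s|%N) y = 0 -> f y = 0) ->
     Ex P' (fun w => f (window (fun t => Theta t w) (s - i) n.+1))
     = Ex P' (fun w => if nrm (Theta i w) == 0 then 0
                      else f ((nrm (Theta i w))^-1 *:
                              window (fun t => Theta t w) s n.+1)
                           * nrm (Theta i w) `^ alpha)).
Proof.
move=> a0 rX stat _ nN rY Ytail XY Theta; split.
  by move=> A E mA gE; exact: (spectral_indep a0 rX nN rY Ytail XY).
move=> i s n f s0 sn bf frow.
exact: (time_change a0 rX stat nN rY Ytail XY).
Qed.
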